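(* Let $K$ be a non-archimedean local field, let $A,B\in \mathrm{SL}_2(K)$, and let $G=\langle A,B\rangle\le \mathrm{SL}_2(K)$. Consider the following procedure, where $l(\cdot)$ denotes translation length on the Bruhat-Tits tree $T_v$ of $K$. (1) Set $X=A$, $Y=B$. If $l(X)=0$ or $l(Y)=0$ then return false. (2) If $l(X)>l(Y)$ then swap $X$ and $Y$. (3) Compute $m=\min\{l(XY),l(X^{-1}Y)\}$. (4) If $m=0$ then return false. (5) If $m\le l(Y)-l(X)$ then replace $Y$ by an element of $\{XY,X^{-1}Y\}$ which has translation length $m$ and return to step (2). (6) Otherwise return true and the pair $(X,Y)$. Then for all $A,B\in\mathrm{SL}_2(K)$ the procedure terminates after finitely many steps. If $G$ is discrete and free of rank two, then it returns true together with a pair $(X,Y)$ which generates $G$ and satisfies the hypotheses of the Ping Pong Lemma for the action on $T_v$; that is, there exist non-empty closed pairwise disjoint subsets $U_+,U_-,V_+,V_-$ of $T_v$, which do not cover $T_v$, such that $X(T_v\setminus U_-)\subseteq U_+$, $X^{-1}(T_v\setminus U_+)\subseteq U_-$, $Y(T_v\setminus V_-)\subseteq V_+$ and $Y^{-1}(T_v\setminus V_+)\subseteq V_-$. If $G$ is not both discrete and free of rank two, then it returns false.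
   Context: A non-archimedean local field $K$ is a field complete with respect to a discrete valuation $v$ with finite residue field; $v$ is normalised so that a uniformiser $\pi$ has $v(\pi)=1$, and $\mathcal{O}=\{x\in K: v(x)\ge 0\}$. The group $\mathrm{SL}_2(K)$ carries the subspace topology from $K^4$; a subgroup is discrete if its subspace topology is discrete. The Bruhat-Tits tree $T_v$ is the simplicial tree whose vertices are the homothety classes of $\mathcal{O}$-lattices (free $\mathcal{O}$-submodules of rank two spanning $K^2$; $L\sim xL$ for $x\in K^\times$), two vertices being adjacent if they have representatives $L_0\subseteq L$ with $L/L_0\cong \mathcal{O}/\pi\mathcal{O}$. It is regarded as a metric space (its geometric realisation with edges of length one and path metric $d$), and $\mathrm{SL}_2(K)$ acts on it by isometries without inversions (no element swaps two adjacent vertices). The translation length of $g\in\mathrm{SL}_2(K)$ is $l(g)=\min_{x\in V(T_v)}d(x,gx)$; it is known that $l(g)=-2\min\{0,v(\mathrm{tr}(g))\}$. *)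

(* Defs.v *)
From HB Require Import structures.
From mathcomp Require Import all_boot all_order all_algebra.
From mathcomp Require Import all_classical all_reals all_analysis.
From Stdlib Require Import Relation_Operators.

Set Implicit Arguments.
Unset Strict Implicit.
Unset Printing Implicit Defensive.

Import Order.TTheory GRing.Theory Num.Theory.

Local Open Scope classical_set_scope.
Local Open Scope ring_scope.

(* The valuation takes its values in \bar int, with v(0) = +oo.
   The residue classes in residue_field_finite are the cosets x + pi O. *)
HB.mixin Record Field_isLocal K & GRing.Field K & Uniform K := {
  valuation : K -> \bar int;
  valuation_neqNy : forall x, valuation x != -oo%E;
  valuation_eqy : forall x, (valuation x == +oo%E) = (x == 0);
  valuationM : forall x y,
    valuation (x * y) = (valuation x + valuation y)%E;
  valuationD : forall x y,
    (Order.min (valuation x) (valuation y) <= valuation (x + y)%R)%E;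
  uniformizer_ex : exists x, valuation x = 1%:E;
  entourage_valuation : @entourage K =
    [set E | exists n : int,
       forall x y, (n%:E <= valuation (x - y)%R)%E -> E (x, y)];
  valuation_complete : forall F : set_system K,
    ProperFilter F -> cauchy F -> exists x : K, F --> x;
  residue_field_finite : finite_set
    [set [set y | (1%:E <= valuation (y - x)%R)%E]
       | x in [set x | (0%:E <= valuation x)%E]]
}.

#[short(type="localFieldType")]
HB.structure Definition LocalField :=
  {K of GRing.Field K & Uniform K & Field_isLocal K}.

Section SL2.
Variable K : localFieldType.

Definition SL2 : Type := [set M : 'M[K]_2 | \det M = 1].
HB.instance Definition _ := Choice.copy SL2 [set M : 'M[K]_2 | \det M = 1].
(* the subspace topology from 'M[K]_2 *)
HB.instance Definition _ :=
  Topological.copy SL2 [set M : 'M[K]_2 | \det M = 1].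

Definition mx_of_SL2 (g : SL2) : 'M[K]_2 := val g.

Lemma det_SL2 (g : SL2) : \det (mx_of_SL2 g) = 1.
Proof. by have /set_mem := valP g. Qed.

Definition mk_SL2 (M : 'M[K]_2) (h : \det M = 1) : SL2 := exist _ M (mem_set h).

Lemma SL2_inj : injective mx_of_SL2.
Proof. exact: val_inj. Qed.

Lemma SL2_unit (g : SL2) : mx_of_SL2 g \in unitmx.
Proof. by rewrite unitmxE det_SL2 unitr1. Qed.

Let det_one : \det (1%:M : 'M[K]_2) = 1. Proof. exact: det1. Qed.
Let det_mul (g h : SL2) : \det (mx_of_SL2 g *m mx_of_SL2 h) = 1.
Proof. by rewrite det_mulmx !det_SL2 mulr1. Qed.
Let det_inv (g : SL2) : \det (invmx (mx_of_SL2 g)) = 1.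
Proof. by rewrite det_inv det_SL2 invr1. Qed.

Definition SL2_one : SL2 := mk_SL2 det_one.
Definition SL2_mul (g h : SL2) : SL2 := mk_SL2 (det_mul g h).
Definition SL2_inv (g : SL2) : SL2 := mk_SL2 (det_inv g).

Lemma SL2_mulA : associative SL2_mul.
Proof. by move=> x y z; apply: SL2_inj; exact: mulmxA. Qed.
Lemma SL2_mul1g : left_id SL2_one SL2_mul.
Proof. by move=> x; apply: SL2_inj; exact: mul1mx. Qed.
Lemma SL2_mulg1 : right_id SL2_one SL2_mul.
Proof. by move=> x; apply: SL2_inj; exact: mulmx1. Qed.
Lemma SL2_mulVg : left_inverse SL2_one SL2_inv SL2_mul.
Proof. by move=> x; apply: SL2_inj; exact: mulVmx (SL2_unit x). Qed.
Lemma SL2_mulgV : right_inverse SL2_one SL2_inv SL2_mul.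
Proof. by move=> x; apply: SL2_inj; exact: mulmxV (SL2_unit x). Qed.

HB.instance Definition _ := isGroup.Build SL2
  SL2_mulA SL2_mul1g SL2_mulg1 SL2_mulVg SL2_mulgV.

(* The coercion of the set H to a type carries the subspace topology. *)
Definition discrete_subgroup (H : set SL2) := forall U : set H, open U.

End SL2.

Section groups.
Local Open Scope group_scope.
Variable gT : groupType.

Definition generated (S : set gT) : set gT :=
  smallest [set H : set gT | group_closed [in H]] S.

(* A word in X^{+-1}, Y^{+-1}: in the letter (i, e), i selects the generator
   (Y if i holds) and e tells whether it is inverted. *)
Definition letter (X Y : gT) (a : bool * bool) : gT :=
  let Z := if a.1 then Y else X in if a.2 then Z^-1 else Z.

Definition word_val (X Y : gT) (w : seq (bool * bool)) : gT :=
  \prod_(a <- w) letter X Y a.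

Definition reduced (w : seq (bool * bool)) : bool :=
  sorted (fun a b => ~~ ((a.1 == b.1) && (a.2 != b.2))) w.

Definition free_of_rank_two (H : set gT) :=
  exists X Y, [/\ H X, H Y &
    forall h, H h -> exists! w, reduced w /\ word_val X Y w = h].

End groups.

Section vertices.
Variable K : localFieldType.

Definition integers : set K := [set x | (0%:E <= valuation x)%E].
(* pi O, for any uniformiser pi *)
Definition max_ideal : set K := [set x | (1%:E <= valuation x)%E].

Definition is_lattice (L : set 'cV[K]_2) :=
  exists e f : 'cV[K]_2,
  [/\ L = [set u | exists a b,
         [/\ integers a, integers b & u = a *: e + b *: f]],
      forall a b, integers a -> integers b ->
        a *: e + b *: f = 0 -> a = 0 /\ b = 0 &
      forall u, exists a b, u = a *: e + b *: f].

Definition homothety_class (L : set 'cV[K]_2) : set (set 'cV[K]_2) :=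
  [set M | exists2 x : K, x != 0 & M = [set x *: u | u in L]].

Record vertex := Vertex {
  lattices : set (set 'cV[K]_2);
  vertexP : exists2 L, is_lattice L & lattices = homothety_class L
}.
HB.instance Definition _ := gen_eqMixin vertex.
HB.instance Definition _ := gen_choiceMixin vertex.

(* L / L0 is isomorphic to O / pi O as an O-module: phi lifts a surjective
   O-linear map from L to O / pi O with kernel L0. *)
Definition residual_quotient (L L0 : set 'cV[K]_2) :=
  exists phi : 'cV[K]_2 -> K,
  [/\ forall u, L u -> integers (phi u),
      forall a u w, integers a -> L u -> L w ->
        max_ideal (phi (a *: u + w) - (a * phi u + phi w)),
      forall c, integers c -> exists2 u, L u & max_ideal (phi u - c) &
      forall u, L u -> (max_ideal (phi u) <-> L0 u)].

Definition adjacent (x y : vertex) :=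
  exists L L0, [/\ (lattices x L /\ lattices y L0) \/ (lattices x L0 /\ lattices y L),
                   L0 `<=` L & residual_quotient L L0].

Definition act_set (g : SL2 K) (L : set 'cV[K]_2) : set 'cV[K]_2 :=
  [set mx_of_SL2 g *m u | u in L].

Lemma act_setK (g h : SL2 K) (L : set 'cV[K]_2) :
  (h * g)%g = 1%g -> act_set h (act_set g L) = L.
Proof.
move=> /(congr1 (@mx_of_SL2 K)) /= hg1.
have hgE u : mx_of_SL2 h *m (mx_of_SL2 g *m u) = u.
  by rewrite mulmxA [X in X *m _]hg1 mul1mx.
apply/seteqP; split=> u.
  by move=> [_ [w Lw <-] <-]; rewrite hgE.
by move=> Lu; exists (mx_of_SL2 g *m u) => //; exists u.
Qed.

Lemma act_set_lattice g L : is_lattice L -> is_lattice (act_set g L).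
Proof.
move=> [e [f [-> indep span]]].
set M := mx_of_SL2 g.
have ME a b : a *: (M *m e) + b *: (M *m f) = M *m (a *: e + b *: f).
  by rewrite mulmxDr !scalemxAr.
exists (M *m e), (M *m f); split.
- apply/seteqP; split=> u.
    by move=> [_ [a [b [Oa Ob ->]]] <-]; exists a, b; rewrite ME.
  move=> [a [b [Oa Ob ->]]]; exists (a *: e + b *: f); last by rewrite ME.
  by exists a, b.
- move=> a b Oa Ob; rewrite ME => /(congr1 (mulmx (invmx M))).
  by rewrite mulKmx ?SL2_unit// mulmx0; exact: indep.
- move=> u; have [a [b uE]] := span (invmx M *m u).
  by exists a, b; rewrite ME -uE mulKVmx ?SL2_unit.
Qed.

Lemma act_homothety_class g L :
  [set act_set g M | M in homothety_class L] = homothety_class (act_set g L).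
Proof.
have gZ x : act_set g [set x *: u | u in L] = [set x *: u | u in act_set g L].
  apply/seteqP; split=> u.
    move=> [_ [w Lw <-] <-]; exists (mx_of_SL2 g *m w); first by exists w.
    by rewrite scalemxAr.
  move=> [_ [w Lw <-] <-]; exists (x *: w); first by exists w.
  by rewrite scalemxAr.
apply/seteqP; split=> M.
  by move=> [_ [x x0 ->] <-]; exists x.
move=> [x x0 ->]; exists [set x *: u | u in L] => //.
by exists x.
Qed.

Lemma act_vertex_subproof (g : SL2 K) (x : vertex) :
  exists2 L, is_lattice L & [set act_set g M | M in lattices x] = homothety_class L.
Proof.
have [L latL ->] := vertexP x.
exists (act_set g L); first exact: act_set_lattice.
exact: act_homothety_class.
Qed.

Definition act_vertex (g : SL2 K) (x : vertex) : vertex :=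
  Vertex (act_vertex_subproof g x).

Lemma vertex_inj (x y : vertex) : lattices x = lattices y -> x = y.
Proof.
case: x y => [C hC] [D hD] /= CD; subst D.
by congr Vertex; exact: Prop_irrelevance.
Qed.

Lemma act_vertexK (g h : SL2 K) :
  (h * g)%g = 1%g -> cancel (act_vertex g) (act_vertex h).
Proof.
move=> hg1 x; apply: vertex_inj => /=; apply/seteqP; split=> L.
  by move=> [_ [M xM <-] <-]; rewrite act_setK.
by move=> xL; exists (act_set g L); [exists L|rewrite act_setK].
Qed.

Lemma act_vertex_adjacent g x y :
  adjacent x y -> adjacent (act_vertex g x) (act_vertex g y).
Proof.
move=> [L [L0 [xy L0L [phi [phiO philin phisurj phiker]]]]].
pose M := mx_of_SL2 g.
have MK : cancel (mulmx M) (mulmx (invmx M) : 'cV[K]_2 -> 'cV[K]_2).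
  by move=> u; rewrite mulKmx ?SL2_unit.
exists (act_set g L), (act_set g L0); split.
- by case: xy => -[? ?]; [left|right]; split; [exists L|exists L0|exists L0|exists L].
- by move=> _ [u L0u <-]; exists u => //; exact: L0L.
exists (fun u => phi (invmx M *m u)); split.
- by move=> _ [u Lu <-]; rewrite MK; exact: phiO.
- move=> a _ _ Oa [u Lu <-] [w Lw <-].
  by rewrite mulmxDr -scalemxAr !MK; exact: philin.
- move=> c /phisurj[u Lu ?]; exists (M *m u); first by exists u.
  by rewrite MK.
- move=> _ [u Lu <-]; rewrite MK; split.
    by move=> /(phiker _ Lu) ?; exists u.
  by move=> [w L0w /(can_inj MK) wu]; apply/(phiker _ Lu); rewrite -wu.
Qed.

End vertices.

Section tree.
Variables (R : realType) (K : localFieldType).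

(* barycentric coordinates of the point at distance t from u on the edge uw *)
Definition edge_point (u w : vertex K) (t : R) : vertex K -> R :=
  fun z => (1 - t) * (z == u)%:R + t * (z == w)%:R.

(* The geometric realisation, in barycentric coordinates; the degenerate case
   u = w gives the vertices themselves. *)
Record bt_tree := TreePoint {
  barycentric :> vertex K -> R;
  barycentricP : exists u w t,
    [/\ u = w \/ adjacent u w, 0 <= t <= 1 & barycentric = edge_point u w t]
}.
HB.instance Definition _ := gen_eqMixin bt_tree.
HB.instance Definition _ := gen_choiceMixin bt_tree.

(* pl_path p q l: some piecewise linear path of length l from p to q *)
Inductive pl_path : bt_tree -> bt_tree -> R -> Prop :=
| pl_path_nil p : pl_path p p 0
| pl_path_cons p q r l u w s t :
    adjacent u w -> 0 <= s <= 1 -> 0 <= t <= 1 ->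
    barycentric p = edge_point u w s -> barycentric q = edge_point u w t ->
    pl_path q r l -> pl_path p r (`|s - t| + l).

Definition tree_dist (p q : bt_tree) : \bar R :=
  ereal_inf [set l%:E | l in pl_path p q].

Definition tree_ball (p : bt_tree) (e : R) : set bt_tree :=
  [set q | (tree_dist p q < e%:E)%E].

Lemma pl_path_cat p q r k l : pl_path p q k -> pl_path q r l -> pl_path p r (k + l).
Proof.
elim=> [{}p|{}p q' {}q {}k u w s t uw s01 t01 pE qE _ IH] qr.
  by rewrite add0r.
by rewrite -addrA; apply: pl_path_cons uw s01 t01 pE qE (IH qr).
Qed.

Lemma pl_path_sym p q l : pl_path p q l -> pl_path q p l.
Proof.
elim=> [{}p|{}p q' {}q {}l u w s t uw s01 t01 pE qE _ IH].
  exact: pl_path_nil.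
rewrite addrC; apply: pl_path_cat IH _; rewrite distrC -[`|_|]addr0.
exact: pl_path_cons uw t01 s01 qE pE (pl_path_nil _).
Qed.

Lemma tree_ball_center p (e : R) : 0 < e -> tree_ball p e p.
Proof.
move=> e0; apply: (@le_lt_trans _ _ 0%:E); last by rewrite lte_fin.
by apply: ereal_inf_lbound; exists 0 => //; exact: pl_path_nil.
Qed.

Lemma tree_ball_sym p q (e : R) : tree_ball p e q -> tree_ball q e p.
Proof.
rewrite /tree_ball /=; congr (ereal_inf _ < _)%E.
by apply/seteqP; split=> _ [l /pl_path_sym ? <-]; exists l.
Qed.

Lemma tree_ball_triangle p q r (e1 e2 : R) :
  tree_ball p e1 q -> tree_ball q e2 r -> tree_ball p (e1 + e2) r.
Proof.
move=> /ereal_inf_lt[_ [k pq <-] ke] /ereal_inf_lt[_ [l qr <-] le].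
apply: (@le_lt_trans _ _ (k + l)%:E).
  by apply: ereal_inf_lbound; exists (k + l) => //; exact: pl_path_cat pq qr.
by rewrite EFinD EFinD lteD.
Qed.

HB.instance Definition _ := hasNbhs.Build bt_tree
  (nbhs_ (entourage_ tree_ball)).
HB.instance Definition _ := Nbhs_isPseudoMetric.Build R bt_tree
  erefl tree_ball_center tree_ball_sym tree_ball_triangle erefl.

Lemma act_tree_subproof (g : SL2 K) (p : bt_tree) : exists u w t,
  [/\ u = w \/ adjacent u w, 0 <= t <= 1 &
      barycentric p \o act_vertex (g^-1)%g = edge_point u w t].
Proof.
have [u [w [t [uw t01 ->]]]] := barycentricP p.
exists (act_vertex g u), (act_vertex g w), t; split=> //.
  by case: uw => [->|uw]; [left|right; exact: act_vertex_adjacent].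
have gE (z x : vertex K) : (act_vertex (g^-1)%g z == x) = (z == act_vertex g x).
  apply/eqP/eqP => [<-|->].
    by rewrite (act_vertexK (mulgV g)).
  by rewrite (act_vertexK (mulVg g)).
by apply/funext => z; rewrite /edge_point /= !gE.
Qed.

Definition act_tree (g : SL2 K) (p : bt_tree) : bt_tree :=
  TreePoint (act_tree_subproof g p).

Lemma vertex_point_subproof (x : vertex K) : exists u w t,
  [/\ u = w \/ adjacent u w, 0 <= t <= 1 &
      edge_point x x 0 = edge_point u w t].
Proof. by exists x, x, 0; split; [left|rewrite lexx ler01|]. Qed.

Definition vertex_point (x : vertex K) : bt_tree :=
  TreePoint (vertex_point_subproof x).

(* The infimum is a minimum: distances between vertices are integers. *)
Definition translation_length (g : SL2 K) : \bar R :=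
  ereal_inf (range (fun x =>
    tree_dist (vertex_point x) (act_tree g (vertex_point x)))).

Definition ping_pong (X Y : SL2 K) :=
  exists Up Um Vp Vm : set bt_tree,
  [/\ [/\ Up !=set0, Um !=set0, Vp !=set0 & Vm !=set0],
      [/\ closed Up, closed Um, closed Vp & closed Vm],
      [/\ Up `&` Um = set0, Up `&` Vp = set0 & Up `&` Vm = set0] /\
        [/\ Um `&` Vp = set0, Um `&` Vm = set0 & Vp `&` Vm = set0],
      Up `|` Um `|` Vp `|` Vm <> setT &
      [/\ act_tree X @` (~` Um) `<=` Up,
          act_tree (X^-1)%g @` (~` Up) `<=` Um,
          act_tree Y @` (~` Vm) `<=` Vp &
          act_tree (Y^-1)%g @` (~` Vp) `<=` Vm]].

End tree.

Section procedure.
Local Open Scope ereal_scope.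
Variables (R : realType) (K : localFieldType).

Let l : SL2 K -> \bar R := @translation_length R K.

Definition min_length (X Y : SL2 K) : \bar R :=
  Order.min (l (X * Y)%g) (l (X^-1 * Y)%g).

(* Start tests that neither generator is elliptic, Sort swaps the generators
   if necessary, Test computes m and branches on it.  Return None stands for
   "return false", Return (Some (X, Y)) for "return true and (X, Y)". *)
Inductive state :=
| Start of SL2 K & SL2 K
| Sort of SL2 K & SL2 K
| Test of SL2 K & SL2 K
| Return of option (SL2 K * SL2 K).

(* Non-deterministic: X * Y and X^-1 * Y may both have translation length m. *)
Inductive proc_step : state -> state -> Prop :=
| step_elliptic A B :
    l A = 0 \/ l B = 0 -> proc_step (Start A B) (Return None)
| step_start A B :
    l A <> 0 -> l B <> 0 -> proc_step (Start A B) (Sort A B)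
| step_swap X Y : l Y < l X -> proc_step (Sort X Y) (Test Y X)
| step_noswap X Y : l X <= l Y -> proc_step (Sort X Y) (Test X Y)
| step_false X Y : min_length X Y = 0 -> proc_step (Test X Y) (Return None)
| step_replace X Y Z :
    min_length X Y <> 0 -> min_length X Y <= l Y - l X ->
    Z = (X * Y)%g \/ Z = (X^-1 * Y)%g -> l Z = min_length X Y ->
    proc_step (Test X Y) (Sort X Z)
| step_true X Y :
    min_length X Y <> 0 -> l Y - l X < min_length X Y ->
    proc_step (Test X Y) (Return (Some (X, Y))).

(* every run from s reaches some Return after finitely many steps *)
Inductive terminates : state -> Prop :=
| terminates_return o : terminates (Return o)
| terminates_step s : (exists s', proc_step s s') ->
    (forall s', proc_step s s' -> terminates s') -> terminates s.

Definition may_return (A B : SL2 K) (o : option (SL2 K * SL2 K)) :=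
  clos_refl_trans_1n state proc_step (Start A B) (Return o).

End procedure.

(* Main.v *)
(* Up to homothety every lattice is spanned by (a, 1) and (pi^n, 0), so the
   vertices of the tree are the balls a + pi^n O of K, a ball being adjacent to
   the next larger ball with the same centre. The level of the smallest ball
   containing two given balls is an ultrametric function, whence the graph
   distance satisfies the four-point condition; it has even displacements on
   SL2, since determinant one preserves the index of lattices. Translation lengths
   are governed by these two facts and the existence of geodesics alone.

   For a vertex p, the points closer to X p than to p and those closer to X^-1 p
   than to p (ties being given to X^-1 p) form two half-trees exchanged by X up
   to complement. By the four-point condition the half-trees of X and Y are
   disjoint as soon as the translates of p are far enough from each other, and
   this gives ping-pong. Such a p exists when [min (l (XY), l (X^-1 Y))] exceeds
   [|l X - l Y|]: minimise d (p, Xp) + d (p, Yp); if p is off one of the axes it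
   is on the bridge between them, and otherwise it can be moved along the common
   segment, shorter than both translation lengths, to its middle. Ties must be
   broken asymmetrically because this middle need not be a vertex.

   Ping-pong yields freeness and a vertex with trivial stabiliser, hence
   discreteness, vertex stabilisers being open. Conversely an elliptic element
   of a discrete group has finite order, by the pigeonhole principle for its
   powers modulo pi^N, so in a discrete free group it is trivial, and the
   procedure cannot return false. *)

Require Import Defs.
From HB Require Import structures.
From mathcomp Require Import all_boot all_order all_algebra.
From mathcomp Require Import all_classical all_reals all_analysis.
From mathcomp Require Import zify ring lra.

Set Implicit Arguments.
Unset Strict Implicit.
Unset Printing Implicit Defensive.

Import Order.TTheory GRing.Theory Num.Theory.

Local Open Scope classical_set_scope.
Local Open Scope ring_scope.

(* [adjacent] is also the name of a constant of all_analysis. *)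
Local Notation adjacent := Defs.adjacent.

(** * The valuation *)

Section valuation.
Variable K : localFieldType.
Implicit Types (x y : K) (n m : int).

Definition vge n x : bool := (n%:E <= valuation x)%E.
Definition ord x : int := fine (valuation x).

Lemma integersE x : integers x = vge 0 x. Proof. by []. Qed.

Lemma max_idealE x : max_ideal x = vge 1 x. Proof. by []. Qed.

Lemma valuation_ord x : x != 0 -> valuation x = (ord x)%:E.
Proof.
rewrite /ord -valuation_eqy; have := valuation_neqNy x.
by case: (valuation x).
Qed.

Lemma vge0 n : vge n 0.
Proof.
rewrite /vge; have /eqP -> : valuation (0 : K) == +oo%E by rewrite valuation_eqy.
by rewrite leey.
Qed.

Lemma vgeE n x : x != 0 -> vge n x = (n <= ord x).
Proof. by move=> x0; rewrite /vge valuation_ord// lee_fin. Qed.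

Lemma vgeD n x y : vge n x -> vge n y -> vge n (x + y).
Proof.
rewrite /vge => nx ny; apply: le_trans (valuationD x y).
by rewrite le_min nx.
Qed.

Lemma ordM x y : x != 0 -> y != 0 -> ord (x * y) = ord x + ord y.
Proof.
by move=> x0 y0; rewrite {1}/ord valuationM !valuation_ord.
Qed.

Lemma ord_one : ord (1 : K) = 0.
Proof.
have : ord (1 : K) = ord (1 : K) + ord (1 : K).
  by rewrite -ordM ?oner_neq0// mulr1.
lia.
Qed.

Lemma ordN1 : ord (-1 : K) = 0.
Proof.
have N10 : (-1 : K) != 0 by rewrite oppr_eq0 oner_eq0.
have : ord (-1 : K) + ord (-1 : K) = 0 by rewrite -ordM// mulrNN mulr1 ord_one.
lia.
Qed.

Lemma ordV x : x != 0 -> ord x^-1 = - ord x.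
Proof.
move=> x0; have : ord x + ord x^-1 = 0.
  by rewrite -ordM ?invr_neq0// divff// ord_one.
lia.
Qed.

Lemma vgeM n m x y : vge n x -> vge m y -> vge (n + m) (x * y).
Proof.
have [->|x0] := eqVneq x 0; first by rewrite mul0r !vge0.
have [->|y0] := eqVneq y 0; first by rewrite mulr0 !vge0.
rewrite !vgeE ?mulf_neq0// ordM//; lia.
Qed.

Lemma vgeMl n x y : vge 0 x -> vge n y -> vge n (x * y).
Proof. by rewrite -[n in vge n (_ * _)]add0r; apply: vgeM. Qed.

Lemma vgeMr n x y : vge n x -> vge 0 y -> vge n (x * y).
Proof. by rewrite mulrC => nx Oy; apply: vgeMl. Qed.

Lemma vgeN n x : vge n (- x) = vge n x.
Proof.
have [->|x0] := eqVneq x 0; first by rewrite oppr0.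
rewrite -mulN1r !vgeE ?mulf_neq0 ?oppr_eq0 ?oner_eq0// ordM ?oppr_eq0 ?oner_eq0//.
by rewrite ordN1 add0r.
Qed.

Lemma vgeB n x y : vge n x -> vge n y -> vge n (x - y).
Proof. by move=> nx ny; apply: vgeD; rewrite ?vgeN. Qed.

Lemma vgeW n m x : m <= n -> vge n x -> vge m x.
Proof. by move=> mn; apply: le_trans; rewrite lee_fin. Qed.

Lemma vge_div n x y : y != 0 -> vge n (x / y) = vge (n + ord y) x.
Proof.
move=> y0; have [->|x0] := eqVneq x 0; first by rewrite mul0r !vge0.
rewrite !vgeE ?mulf_neq0 ?invr_neq0// ordM ?invr_neq0// ordV//; lia.
Qed.

Lemma vge_mulr n x y : y != 0 -> vge n (x * y) = vge (n - ord y) x.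
Proof. by move=> y0; rewrite -[y in LHS]invrK vge_div ?invr_neq0// ordV. Qed.

Lemma vge1 : vge 0 (1 : K).
Proof. by rewrite vgeE ?oner_eq0// ord_one. Qed.

Lemma vge_exists x : exists c, vge c x.
Proof.
have [->|x0] := eqVneq x 0; first by exists 0; rewrite vge0.
by exists (ord x); rewrite vgeE.
Qed.

Definition unif : K := sval (cid (uniformizer_ex (s := K))).

Lemma valuation_unif : valuation unif = 1%:E.
Proof. by rewrite /unif; case: cid. Qed.

Lemma unif_neq0 : unif != 0.
Proof. by rewrite -valuation_eqy valuation_unif. Qed.

Lemma ord_unif : ord unif = 1.
Proof. by rewrite /ord valuation_unif. Qed.

Definition upow (n : int) : K := unif ^ n.

Lemma upow_neq0 n : upow n != 0.
Proof. by rewrite expfz_neq0// unif_neq0. Qed.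

Lemma ord_upow n : ord (upow n) = n.
Proof.
have pos k : ord (unif ^+ k) = k%:Z.
  elim: k => [|k IH]; first by rewrite expr0 ord_one.
  by rewrite exprS ordM ?expf_neq0 ?unif_neq0// ord_unif IH intS.
rewrite /upow; case: n => k; first exact: pos.
rewrite (_ : unif ^ Negz k = (unif ^+ k.+1)^-1) // ordV ?expf_neq0 ?unif_neq0// pos
  NegzE //.
Qed.

End valuation.

(** * Lattices and balls *)

Section balls.
Variable K : localFieldType.
Implicit Types (a b c x y l : K) (n m : int) (u w : 'cV[K]_2).

Definition vec x y : 'cV[K]_2 := \col_(i < 2) if i == 0 then x else y.

Lemma vecP u w : u 0 0 = w 0 0 -> u 1 0 = w 1 0 -> u = w.
Proof.
move=> e0 e1; apply/matrixP => i j; rewrite (ord1 j).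
case: i => -[|[|//]] Hi.
- by rewrite (_ : Ordinal Hi = 0)//; apply: val_inj.
- by rewrite (_ : Ordinal Hi = 1)//; apply: val_inj.
Qed.

Lemma scale_setP l (L : set 'cV[K]_2) u : l != 0 ->
  [set l *: w | w in L] u <-> L (l^-1 *: u).
Proof.
move=> l0; split=> [[w Lw <-]|Lu]; first by rewrite scalerA mulVf// scale1r.
by exists (l^-1 *: u) => //; rewrite scalerA mulfV// scale1r.
Qed.

Lemma scale_setM l l' (L : set 'cV[K]_2) :
  [set l *: w | w in [set l' *: w | w in L]] = [set (l * l') *: w | w in L].
Proof.
apply/seteqP; split=> u.
  by move=> [_ [w Lw <-] <-]; exists w; rewrite ?scalerA.
by move=> [w Lw <-]; exists (l' *: w); [exists w|rewrite scalerA].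
Qed.

Lemma scale_set1 (L : set 'cV[K]_2) : [set 1 *: w | w in L] = L.
Proof.
apply/seteqP; split=> u; first by move=> [w Lw <-]; rewrite scale1r.
by move=> Lu; exists u; rewrite ?scale1r.
Qed.

Lemma homothety_class_scale l (L : set 'cV[K]_2) : l != 0 ->
  homothety_class [set l *: w | w in L] = homothety_class L.
Proof.
move=> l0; apply/seteqP; split=> M [z z0 ->].
  by exists (z * l); rewrite ?mulf_neq0// scale_setM.
exists (z / l); first by rewrite mulf_neq0// invr_neq0.
by rewrite scale_setM divfK.
Qed.

Lemma latticesE (v : vertex K) L : lattices v L -> lattices v = homothety_class L.
Proof.
by have [L' _ ->] := vertexP v; move=> [z z0 ->]; rewrite homothety_class_scale.
Qed.

(* The lattice spanned by (a, 1) and (pi^n, 0); up to homothety it stands for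
   the ball a + pi^n O of K. *)
Definition blat a n : set 'cV[K]_2 :=
  [set u | vge 0 (u 1 0) /\ vge n (u 0 0 - a * u 1 0)].

Lemma blat_span a n : blat a n = [set u | exists s t,
  [/\ integers s, integers t & u = s *: vec a 1 + t *: vec (upow K n) 0]].
Proof.
apply/seteqP; split=> u.
  move=> [u1 u0]; exists (u 1 0), ((u 0 0 - a * u 1 0) / upow K n); split=> //.
    by rewrite /integers /= -/(vge _ _) vge_div ?upow_neq0// ord_upow add0r.
  apply: vecP; rewrite !mxE /=; last by rewrite mulr0 addr0 mulr1.
  by rewrite divfK ?upow_neq0// mulrC subrKC.
move=> [s [t [Os Ot ->]]]; split; rewrite !mxE /=.
  by rewrite mulr0 addr0 mulr1.
rewrite mulr0 addr0 mulr1 (_ : _ - _ = t * upow K n); last by ring.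
by rewrite vge_mulr ?upow_neq0// ord_upow subrr.
Qed.

Lemma is_lattice_blat a n : is_lattice (blat a n).
Proof.
exists (vec a 1), (vec (upow K n) 0); split; first exact: blat_span.
- move=> s t _ _ /matrixP h.
  have := h 1 0; rewrite !mxE /= mulr0 addr0 mulr1 => s0; split=> //.
  have := h 0 0; rewrite !mxE /= s0 mul0r add0r => /eqP.
  by rewrite mulf_eq0 (negPf (upow_neq0 _ _)) orbF => /eqP.
- move=> u; exists (u 1 0), ((u 0 0 - a * u 1 0) / upow K n).
  apply: vecP; rewrite !mxE /=; last by rewrite mulr0 addr0 mulr1.
  by rewrite divfK ?upow_neq0// mulrC subrKC.
Qed.

Definition vtx a n : vertex K :=
  Vertex (ex_intro2 _ _ (blat a n) (is_lattice_blat a n) erefl).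

Lemma lattice_vtx (v : vertex K) l a n : l != 0 ->
  lattices v [set l *: u | u in blat a n] -> v = vtx a n.
Proof.
by move=> l0 /latticesE vE; apply: vertex_inj; rewrite vE homothety_class_scale.
Qed.

(** Hermite normal form: the second coordinate of [e] divides that of [f], so [e] serves as pivot
    and [f] is reduced to [(d, 0)]. Dividing by [e 1 0] gives the basis of a ball lattice, up to a
    unit in the second vector. *)
Lemma lattice_hermite L (e f : 'cV[K]_2) : e 1 0 != 0 -> vge 0 (f 1 0 / e 1 0) ->
  L = [set u | exists a b, [/\ integers a, integers b & u = a *: e + b *: f]] ->
  (forall u, exists a b, u = a *: e + b *: f) ->
  exists l a n, l != 0 /\ L = [set l *: u | u in blat a n].
Proof.
move=> e0 ef LE span; pose c := f 1 0 / e 1 0; pose d := f 0 0 - c * e 0 0.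
have d0 : d != 0.
  (* With [d = 0], [f] would be a multiple of [e] and the span would miss [vec 1 0]. *)
  apply/eqP => d0; have [s [t /matrixP h]] := span (vec 1 0).
  have := h 0 0; have := h 1 0; rewrite !mxE /= => h1 h0.
  have /eqP := oner_neq0 K; apply; rewrite {}h0.
  have -> : f 0 0 = c * e 0 0 by apply/eqP; rewrite -subr_eq0 -/d d0.
  have -> : s = - (t * c).
    apply: (mulIf e0); rewrite mulNr -mulrA divfK//.
    by apply/eqP; rewrite -addr_eq0 -h1.
  by ring.
pose n := ord (d / e 1 0).
exists (e 1 0), (e 0 0 / e 1 0), n; split=> //.
have dn : vge n (d / e 1 0) by rewrite vgeE ?mulf_neq0 ?invr_neq0.
have nE : n + ord (e 1 0) = ord d.
  by rewrite /n ordM ?invr_neq0// ordV// subrK.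
rewrite {}LE; apply/seteqP; split=> u.
  move=> [s [t [Os Ot ->]]]; apply/scale_setP => //; split; rewrite !mxE /=.
    rewrite mulrDr [X in X + _]mulrC mulfK// [X in _ + X](_ : _ = t * c); last first.
      by rewrite /c; ring.
    by apply: vgeD => //; apply: vgeMl.
  rewrite (_ : _ - _ = t * (d / e 1 0)); last first.
    by rewrite /d /c; field.
  exact: vgeMl.
move=> /scale_setP-/(_ e0)[]; rewrite !mxE; set w1 := _ * u 1 0 => v1.
set w0 := _ - _ => v0.
have wE : u 1 0 = e 1 0 * w1 by rewrite /w1 mulrA divff// mul1r.
have w0E : u 0 0 = e 1 0 * w0 + e 0 0 * w1.
  by rewrite /w0 /w1; field.
pose t := e 1 0 * w0 / d.
have Ot : vge 0 t.
  by rewrite /t vge_div// mulrC vge_mulr// -nE add0r addrK.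
exists (w1 - t * c), t; split=> //.
  by apply: vgeB => //; apply: vgeMl.
apply: vecP; rewrite !mxE.
  by rewrite w0E /t /d; field; rewrite -/d d0.
by rewrite wE /c; field.
Qed.

Lemma lattice_ball L : is_lattice L ->
  exists l a n, l != 0 /\ L = [set l *: u | u in blat a n].
Proof.
move=> [e [f [LE _ span]]].
have LE' : L = [set u | exists a b, [/\ integers a, integers b & u = a *: f + b *: e]].
  by rewrite LE; apply/seteqP; split=> u [s [t [Os Ot ->]]];
    exists t, s; rewrite addrC.
have span' u : exists a b, u = a *: f + b *: e.
  by have [s [t ->]] := span u; exists t, s; rewrite addrC.
have [e0|e0] := eqVneq (e 1 0) 0.
  have f0 : f 1 0 != 0.
    apply/eqP => f0; have [s [t /matrixP/(_ 1 0)]] := span (vec 0 1).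
    by rewrite !mxE /= e0 f0 !mulr0 addr0 => /eqP; rewrite oner_eq0.
  by apply: lattice_hermite LE' span' => //; rewrite e0 mul0r vge0.
have [f0|f0] := eqVneq (f 1 0) 0.
  by apply: lattice_hermite LE span => //; rewrite f0 mul0r vge0.
have [ef|fe] := leP (ord (e 1 0)) (ord (f 1 0)).
  by apply: lattice_hermite LE span => //; rewrite vge_div// vgeE// add0r.
by apply: lattice_hermite LE' span' => //; rewrite vge_div// vgeE// add0r ltW.
Qed.

Lemma vtx_ex (v : vertex K) : exists a n, v = vtx a n.
Proof.
have [L /lattice_ball[l [a [n [l0 LE]]]] vE] := vertexP v.
exists a, n; apply: (lattice_vtx l0).
by rewrite vE -LE; exists 1; rewrite ?oner_neq0// scale_set1.
Qed.

Lemma blat_vec a n : blat a n (vec a 1).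
Proof. by split; rewrite !mxE /= ?vge1// mulr1 subrr vge0. Qed.

Lemma blat_pi a n : blat a n (vec (upow K n) 0).
Proof. by split; rewrite !mxE /= ?vge0// mulr0 subr0 vgeE ?upow_neq0// ord_upow. Qed.

Lemma blat_eq a n b m : n = m -> vge n (a - b) -> blat a n = blat b m.
Proof.
move=> <- ab; apply/seteqP; split=> u [u1 u0]; split=> //.
  rewrite (_ : _ - _ = u 0 0 - a * u 1 0 + (a - b) * u 1 0); last by ring.
  by apply: vgeD => //; apply: vgeMr.
rewrite (_ : _ - _ = u 0 0 - b * u 1 0 - (a - b) * u 1 0); last by ring.
by apply: vgeB => //; apply: vgeMr.
Qed.

Lemma vtx_eq a n b m : n = m -> vge n (a - b) -> vtx a n = vtx b m.
Proof. by move=> nm ab; apply: vertex_inj; rewrite /= (blat_eq nm ab). Qed.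

(** Testing both basis vectors in both inclusions forces the homothety factor [l] to be a unit, so a
    vertex determines its ball. *)
Lemma vtx_inj a n b m : vtx a n = vtx b m -> n = m /\ vge n (a - b).
Proof.
move=> vE; have : lattices (vtx b m) (blat a n).
  by rewrite -vE; exists 1; rewrite ?oner_neq0// scale_set1.
move=> [l l0 LE].
have h1 := blat_vec a n; rewrite LE in h1.
move/(scale_setP _ _ l0): h1 => [h1 h2]; rewrite !mxE /= in h1 h2.
have h3 := blat_pi a n; rewrite LE in h3.
move/(scale_setP _ _ l0): h3 => [_ h3]; rewrite !mxE /= in h3.
have [k1 _] : blat a n (l *: vec b 1).
  by rewrite LE; exists (vec b 1) => //; exact: blat_vec.
have [_ k3] : blat a n (l *: vec (upow K m) 0).
  by rewrite LE; exists (vec (upow K m) 0) => //; exact: blat_pi.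
rewrite !mxE /= !mulr0 subr0 in k1 k3 h3.
rewrite mulr1 vgeE ?invr_neq0// ordV// in h1.
rewrite mulr1 vgeE// in k1.
rewrite subr0 vgeE ?mulf_neq0 ?invr_neq0 ?upow_neq0// ordM ?invr_neq0 ?upow_neq0//
  ordV// ord_upow in h3.
rewrite vgeE ?mulf_neq0 ?upow_neq0// ordM ?upow_neq0// ord_upow in k3.
have nm : n = m by lia.
split=> //; rewrite nm; move: h2; rewrite mulr1 [b * _]mulrC -mulrBr mulrC vge_div//.
by apply: vgeW; lia.
Qed.

End balls.

(** * Adjacency as inclusion of consecutive balls *)

Section adjacency.
Variable K : localFieldType.
Implicit Types (a b c l : K) (n m : int) (u w : 'cV[K]_2) (v x y z : vertex K).

Lemma adjacent_sym x y : adjacent x y -> adjacent y x.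
Proof.
move=> [L [L0 [[[h1 h2]|[h1 h2]] h3 h4]]]; exists L, L0; split=> //; by [right|left].
Qed.

Lemma adjacent_child a n : adjacent (vtx a n) (vtx a (n + 1)).
Proof.
have pn0 := upow_neq0 K n.
exists (blat a n), (blat a (n + 1)); split.
- by left; split; exists 1; rewrite ?oner_neq0// scale_set1.
- by move=> u [u1 u0]; split=> //; apply: vgeW u0; lia.
(* The coordinate along [vec (upow K n) 0], which lies in the maximal ideal exactly on the smaller
   lattice. *)
exists (fun u => (u 0 0 - a * u 1 0) / upow K n); split.
- by move=> u [_ u0]; rewrite integersE vge_div// ord_upow add0r.
- move=> t u w _ _ _; rewrite max_idealE !mxE (_ : _ - _ = 0) ?vge0//.
  by field.
- move=> c Oc; exists (c *: vec (upow K n) 0).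
    split; rewrite !mxE /= !mulr0 ?vge0// subr0.
    by rewrite vge_mulr// ord_upow subrr.
  by rewrite max_idealE !mxE /= !mulr0 subr0 mulfK// subrr vge0.
- move=> u [u1 _]; rewrite max_idealE vge_div// ord_upow addrC.
  by split=> [u0|[]].
Qed.

Lemma unit_mul1 c t : vge 0 c -> ~~ vge 1 c -> vge 1 (t * c) = vge 1 t.
Proof.
have [->|c0] := eqVneq c 0; first by rewrite !vge0.
by rewrite vge_mulr// [vge 0 c]vgeE// [vge 1 c]vgeE// => c1 c2;
  rewrite (_ : ord c = 0) ?subr0//; lia.
Qed.

(** Modulo pi, [phi] is a nonzero linear form in the coordinates [al], [be] with respect to the
    basis [e], [f]. Its kernel depends on whether it vanishes on [f]: if so [L0] is the next larger
    ball, otherwise one of the next smaller balls. *)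
Lemma residual_quotient_cases x y (L L0 : set 'cV[K]_2) :
  lattices x L -> lattices y L0 -> L0 `<=` L -> residual_quotient L L0 ->
  exists a n, (x = vtx a n /\ y = vtx a (n + 1)) \/
              (y = vtx a n /\ x = vtx a (n + 1)).
Proof.
have [a [n ->]] := vtx_ex x.
move=> [l l0 ->] yL0 L0L [phi [phiO philin phisurj phiker]].
have pn0 := upow_neq0 K n.
pose L' := [set l *: u | u in blat a n].
pose e := l *: vec a 1; pose f := l *: vec (upow K n) 0.
have Le : L' e by exists (vec a 1) => //; exact: blat_vec.
have Lf : L' f by exists (vec (upow K n) 0) => //; exact: blat_pi.
have L'0 : L' 0.
  by exists 0; rewrite ?scaler0//; split; rewrite !mxE ?mulr0 ?subr0 vge0.
have phi0 : vge 1 (phi 0).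
  have := philin 1 0 0 (vge1 K) L'0 L'0.
  by rewrite scale1r addr0 mul1r opprD addrA subrr sub0r max_idealE vgeN.
pose al u := l^-1 * u 1 0; pose d u := l^-1 * u 0 0 - a * al u.
pose be u := d u / upow K n.
have uE w : w = al w *: e + (be w *: f + 0).
  by apply: vecP; rewrite !mxE /= /be /d /al; field; rewrite ?l0 ?pn0.
have Oal u : L' u -> vge 0 (al u).
  by move=> /(scale_setP _ _ l0)[]; rewrite !mxE.
have dn u : L' u -> vge n (d u).
  by move=> /(scale_setP _ _ l0)[]; rewrite !mxE.
have Obe u : L' u -> vge 0 (be u).
  by move=> /dn; rewrite /be vge_div// ord_upow add0r.
have L'E u : vge 0 (al u) -> vge n (d u) -> L' u.
  by move=> h1 h2; apply/(scale_setP _ _ l0); split; rewrite !mxE.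
have phiE u : L' u -> vge 1 (phi u) = vge 1 (al u * phi e + be u * phi f).
  move=> Lu.
  have h1 := philin (be u) f 0 (Obe u Lu) Lf L'0.
  have Lw : L' (be u *: f + 0).
    rewrite addr0; apply/(scale_setP _ _ l0).
    rewrite scalerA mulrC scalerA divfK//; split; rewrite !mxE /= !mulr0 ?vge0//.
    by rewrite subr0 /be divfK// dn.
  have h2 := philin (al u) e _ (Oal u Lu) Le Lw.
  rewrite -uE in h2; rewrite !max_idealE in h1 h2.
  have h3 : vge 1 (phi u - (al u * phi e + be u * phi f)).
    have := vgeD (vgeD h1 h2) phi0.
    by congr (vge _ _); ring.
  apply/idP/idP => h4; [have := vgeB h4 h3|have := vgeD h4 h3].
    by congr (vge _ _); ring.
  by congr (vge _ _); ring.
have phie := phiO e Le; have phif := phiO f Lf; rewrite !integersE in phie phif.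
have [f1|f1] := boolP (vge 1 (phi f)).
  have e1 : ~~ vge 1 (phi e).
    apply/negP => e1.
    have [u Lu] := phisurj 1 (vge1 K).
    have : vge 1 (phi u) by rewrite phiE// vgeD// vgeMl// ?Oal ?Obe.
    rewrite max_idealE => h1 h2.
    by have := vgeB h1 h2; rewrite opprB addrC subrK vgeE ?oner_neq0// ord_one.
  (* The kernel is spanned by [unif K *: e] and [f]; taking out the factor [unif K] leaves the ball
     of level [n - 1]. *)
  exists a, (n - 1); right; rewrite subrK; split=> //.
  have lp : l * unif K != 0 by rewrite mulf_neq0 ?unif_neq0.
  apply: (lattice_vtx lp);
    suff <- : L0 = [set l * unif K *: u | u in blat a (n - 1)] by [].
  have key u : [set l * unif K *: u | u in blat a (n - 1)] u <-> vge 1 (al u) /\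
    vge n (d u).
    rewrite (scale_setP _ _ lp) /blat /= !mxE invfM.
    rewrite (_ : _ * u 1 0 = al u / unif K); last by rewrite /al; ring.
    rewrite (_ : _ - _ = d u / unif K); last by rewrite /d /al; field;
      rewrite unif_neq0.
    by rewrite !vge_div ?unif_neq0// ord_unif add0r subrK.
  apply/seteqP; split=> u.
    move=> L0u; have Lu := L0L _ L0u; apply/key; split; last exact: dn.
    move/(phiker _ Lu): L0u; rewrite max_idealE phiE// => h.
    have := vgeB h (vgeMl (Obe u Lu) f1).
    by rewrite addrK unit_mul1.
  move=> /key[h1 h2]; have Lu : L' u by apply: L'E => //; apply: vgeW h1.
  apply/(phiker _ Lu); rewrite max_idealE phiE//; apply: vgeD;
    last exact: vgeMl (Obe u Lu) f1.
  by rewrite unit_mul1.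
have f0 : phi f != 0 by apply: contraNneq f1 => ->; rewrite vge0.
pose c := phi e / phi f.
have Oc : vge 0 c.
  have : ord (phi f) = 0 by move: phif f1; rewrite !vgeE//; lia.
  by rewrite /c vge_div// => ->; rewrite addr0.
(* Kernel vectors with [al u = 1] have [be u] congruent to [- c], which moves the centre to
   [a - c * upow K n]. *)
exists (a - c * upow K n), n; left; split.
  by apply: vtx_eq => //; rewrite opprB addrC subrK vge_mulr// ord_upow subrr.
apply: (lattice_vtx l0).
suff <- : L0 = [set l *: u | u in blat (a - c * upow K n) (n + 1)] by [].
have key u : [set l *: u | u in blat (a - c * upow K n) (n + 1)] u <->
    vge 0 (al u) /\ vge 1 (al u * c + be u).
  rewrite (scale_setP _ _ l0) /blat /= !mxE -/(al u).
  rewrite (_ : _ - _ = (al u * c + be u) * upow K n);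
    last by rewrite /be [RHS]mulrDl divfK// /d; ring.
  by rewrite [vge (n + 1) _]vge_mulr// ord_upow addrC addKr.
have phiE' u : L' u -> vge 1 (phi u) = vge 1 (al u * c + be u).
  move=> Lu; rewrite phiE// -[RHS](@unit_mul1 (phi f))//; congr (vge _ _).
  by rewrite /c; field.
apply/seteqP; split=> u.
  move=> L0u; have Lu := L0L _ L0u; apply/key; split; first exact: Oal.
  by move/(phiker _ Lu): L0u; rewrite max_idealE phiE'.
move=> /key[h1 h2].
have Lu : L' u.
  apply: L'E => //.
  have : vge 0 (be u).
    have := vgeB (@vgeW K 1 0 _ isT h2) (vgeMl h1 Oc).
    by congr (vge _ _); ring.
  by rewrite /be vge_div// ord_upow add0r.
by apply/(phiker _ Lu); rewrite max_idealE phiE'.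
Qed.

Lemma adjacent_cases x y : adjacent x y -> exists a n,
  (x = vtx a n /\ y = vtx a (n + 1)) \/ (y = vtx a n /\ x = vtx a (n + 1)).
Proof.
move=> [L [L0 [[[Lx L0y]|[L0x Ly]] L0L LL0]]].
  exact: (residual_quotient_cases Lx L0y).
have [a [n h]] := residual_quotient_cases Ly L0x L0L LL0.
by exists a, n; case: h => ?; [right|left].
Qed.

End adjacency.

(** * The distance on vertices *)

Section vertex_distance.
Variable K : localFieldType.
Implicit Types (a b c l : K) (n m j : int) (x y z p q : vertex K) (g h : SL2 K).

(** The centre is a choice, determined only modulo pi^level; the level is an invariant of the
    vertex. *)
Definition center x : K := sval (cid (vtx_ex x)).
Definition level x : int := sval (cid (svalP (cid (vtx_ex x)))).

Lemma vtxE x : x = vtx (center x) (level x).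
Proof. by rewrite {1}(svalP (cid (svalP (cid (vtx_ex x))))). Qed.

Lemma level_vtx a n : level (vtx a n) = n.
Proof. by have [] := vtx_inj (vtxE (vtx a n)). Qed.

(* The level of the smallest ball containing the balls of x and y. *)
Definition join x y : int :=
  let m := Num.min (level x) (level y) in
  if center x == center y then m else Num.min m (ord (center x - center y)).

(** This description by lower bounds hides the case of equal centres and makes the ultrametric
    inequality visible. *)
Lemma le_join j x y :
  (j <= join x y) = [&& j <= level x, j <= level y & vge j (center x - center y)].
Proof.
rewrite /join; case: eqVneq => [->|ne].
  by rewrite subrr vge0 andbT le_min.
by rewrite !le_min -andbA vgeE// subr_eq0.
Qed.

Lemma le_join_vtx j a n b m :
  (j <= join (vtx a n) (vtx b m)) = [&& j <= n, j <= m & vge j (a - b)].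
Proof.
rewrite le_join !level_vtx; case: (leP j n) => //= jn; case: (leP j m) => //= jm.
have [_] := vtx_inj (vtxE (vtx a n)); set a' := center _; move=> /(vgeW jn) h1.
have [_] := vtx_inj (vtxE (vtx b m)); set b' := center _; move=> /(vgeW jm) h2.
apply/idP/idP => h3.
  have := vgeB (vgeD h3 h1) h2; congr (vge _ _); ring.
have := vgeB (vgeD h3 h2) h1; congr (vge _ _); ring.
Qed.

Lemma joinxx x : join x x = level x.
Proof. by rewrite /join eqxx minxx. Qed.

Lemma joinC x y : join x y = join y x.
Proof.
rewrite /join minC eq_sym; case: eqVneq => // _; congr Num.min.
rewrite -[in LHS]opprB; have [->|ne] := eqVneq (center y - center x) 0.
  by rewrite oppr0.
by rewrite -mulN1r ordM ?oppr_eq0 ?oner_eq0// ordN1 add0r.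
Qed.

Lemma join_ler x y : join x y <= level y.
Proof. by have := lexx (join x y); rewrite le_join => /and3P[]. Qed.

Lemma join_lel x y : join x y <= level x.
Proof. by rewrite joinC join_ler. Qed.

Lemma join_ultra x y z : Num.min (join x y) (join y z) <= join x z.
Proof.
set j := Num.min _ _.
have : j <= join x y by rewrite ge_min lexx.
have : j <= join y z by rewrite ge_min lexx orbT.
rewrite !le_join => /and3P[h1 h2 h3] /and3P[h4 _ h5].
by rewrite h4 h2; have := vgeD h5 h3; rewrite addrA subrK.
Qed.

Lemma join_eq x y : level x = level y -> join x y = level x -> x = y.
Proof.
move=> lxy jx; rewrite (vtxE x) (vtxE y); apply: vtx_eq => //.
by have := lexx (join x y); rewrite {1}jx le_join => /and3P[].
Qed.

(** The geodesic climbs from [x] to the smallest ball containing both and descends to [y]. The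
    integer is nonnegative, so [absz] only changes its type. *)
Definition vdist x y : nat := absz (level x + level y - 2 * join x y)%R.

Lemma vdistE x y : (vdist x y)%:Z = level x + level y - 2 * join x y.
Proof. have := join_ler x y; have := join_lel x y; rewrite /vdist; lia. Qed.

Lemma vdistxx x : vdist x x = 0%N.
Proof. have := vdistE x x; rewrite joinxx; lia. Qed.

Lemma vdistC x y : vdist x y = vdist y x.
Proof. by rewrite /vdist joinC [level x + _]addrC. Qed.

Lemma vdist_eq0 x y : vdist x y = 0%N -> x = y.
Proof.
move=> d0; have := vdistE x y; have := join_ler x y; have := join_lel x y.
by rewrite d0 => *; apply: join_eq; lia.
Qed.

Lemma vdist_triangle x y z : (vdist x z <= vdist x y + vdist y z)%N.
Proof.
have := vdistE x z; have := vdistE x y; have := vdistE y z.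
have := join_ultra x y z; have := join_ler x y; have := join_lel y z; lia.
Qed.

(** Each level occurs twice in the sum: the tree is bipartite. *)
Lemma vdist_parity x y z : ~~ odd (vdist x y + vdist y z + vdist z x).
Proof. have := vdistE z x; have := vdistE x y; have := vdistE y z; lia. Qed.

(** All three sums contain the four levels once, so the levels cancel and the claim reduces to four
    ultrametric inequalities for [join]. *)
Lemma vdist_four x y z p : (vdist x y + vdist z p <= vdist x z + vdist y p)%N \/
  (vdist x y + vdist z p <= vdist x p + vdist y z)%N.
Proof.
have := vdistE x z; have := vdistE x y; have := vdistE y z.
have := vdistE x p; have := vdistE y p; have := vdistE z p.
have := join_ultra x z y; have := join_ultra x p y.
have := join_ultra z x p; have := join_ultra z y p.
rewrite (joinC p y) (joinC z y) (joinC z x); lia.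
Qed.

Lemma vdist_adjacent x y : adjacent x y -> vdist x y = 1%N.
Proof.
suff main a n : vdist (vtx a n) (vtx a (n + 1)) = 1%N.
  by move=> /adjacent_cases[a [n [[-> ->]|[-> ->]]]]; rewrite // vdistC.
have := vdistE (vtx a n) (vtx a (n + 1)); rewrite !level_vtx.
have : join (vtx a n) (vtx a (n + 1)) = n.
  apply/eqP; rewrite eq_le; apply/andP; split.
    by have := join_lel (vtx a n) (vtx a (n + 1)); rewrite level_vtx.
  by rewrite le_join_vtx subrr vge0 lexx/= andbT; lia.
lia.
Qed.

Lemma adjacent_vdist x y z : adjacent x y ->
  vdist x z = (vdist y z).+1 \/ vdist y z = (vdist x z).+1.
Proof.
move=> /vdist_adjacent xy; have := vdist_triangle x y z; have := vdist_triangle y x z.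
have := vdist_parity x y z; rewrite (vdistC y x) (vdistC z x) xy; lia.
Qed.

(** If the ball [x] contains [y], descend to the smaller ball around the centre of [y]; otherwise
    climb to the next larger ball. *)
Lemma vdist_step x y : x <> y -> exists2 z, adjacent x z & vdist x y = (vdist z y).+1.
Proof.
move=> xy; suff [z xz zy] : exists2 z, adjacent x z & (vdist z y < vdist x y)%N.
  by exists z => //; have := adjacent_vdist y xz; lia.
have [jl|jl] := boolP (join x y == level x); last first.
  exists (vtx (center x) (level x - 1)).
    rewrite {1}(vtxE x) -{1}[level x](subrK 1).
    by apply: adjacent_sym; exact: adjacent_child.
  have := vdistE x y; have := vdistE (vtx (center x) (level x - 1)) y.
  have := join_lel x y; rewrite level_vtx.
  have : join x y <= join (vtx (center x) (level x - 1)) y.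
    rewrite {2}(vtxE y) le_join_vtx; have := lexx (join x y).
    by rewrite {1}le_join => /and3P[_ -> ->]; have := join_lel x y; lia.
  lia.
have xE : x = vtx (center y) (level x).
  rewrite {1}(vtxE x); apply: vtx_eq => //.
  by have := lexx (join x y); rewrite {1}(eqP jl) le_join => /and3P[].
have lxy : level x < level y.
  rewrite lt_neqAle -{2}(eqP jl) join_ler andbT; apply/eqP => lxy.
  by apply: xy; apply: join_eq => //; exact/eqP.
exists (vtx (center y) (level x + 1)); first by rewrite {1}xE; exact: adjacent_child.
have := vdistE x y; have := vdistE (vtx (center y) (level x + 1)) y.
rewrite level_vtx (eqP jl).
have : level x + 1 <= join (vtx (center y) (level x + 1)) y.
  by rewrite {2}(vtxE y) le_join_vtx subrr vge0; lia.
lia.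
Qed.

Lemma vdist_between x y k : (k <= vdist x y)%N ->
  exists z, vdist x z = k /\ vdist z y = (vdist x y - k)%N.
Proof.
elim: k => [|k IH] kd; first by exists x; rewrite vdistxx subn0.
have [z [xz zy]] := IH (ltnW kd).
have [|w zw wy] := @vdist_step z y.
  by move=> zy0; move: zy; rewrite zy0 vdistxx; lia.
exists w; move: (vdist_adjacent zw) (vdist_triangle x z w) (vdist_triangle x w y); lia.
Qed.

(** The formula for [vdist] is not visibly equivariant, but the action preserves adjacency and
    distances are realised by chains of edges. *)
Lemma vdist_act_le g x y : (vdist (act_vertex g x) (act_vertex g y) <= vdist x y)%N.
Proof.
move dE : (vdist x y) => d; elim: d x dE => [|d IH] x dE.
  by rewrite (vdist_eq0 dE) vdistxx.
have [|z xz zy] := @vdist_step x y; first by move=> xy; rewrite xy vdistxx in dE.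
have := vdist_adjacent (act_vertex_adjacent g xz).
have := vdist_triangle (act_vertex g x) (act_vertex g z) (act_vertex g y).
have := IH z; lia.
Qed.

Lemma vdist_act g x y : vdist (act_vertex g x) (act_vertex g y) = vdist x y.
Proof.
apply/eqP; rewrite eqn_leq vdist_act_le/=.
by have := vdist_act_le (g^-1)%g (act_vertex g x) (act_vertex g y);
  rewrite !(act_vertexK (mulVg g)).
Qed.

Lemma act_set1 (L : set 'cV[K]_2) : act_set 1%g L = L.
Proof.
apply/seteqP; split=> u; first by move=> [w Lw <-]; rewrite [_ *m _]mul1mx.
by move=> Lu; exists u => //; exact: mul1mx.
Qed.

Lemma act_setM g h (L : set 'cV[K]_2) : act_set (g * h)%g L = act_set g (act_set h L).
Proof.
apply/seteqP; split=> u.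
  by move=> [w Lw <-]; exists (mx_of_SL2 h *m w); [exists w|rewrite mulmxA].
by move=> [_ [w Lw <-] <-]; exists w => //; rewrite mulmxA.
Qed.

Lemma act_vertex1 x : act_vertex 1%g x = x.
Proof.
apply: vertex_inj; apply/seteqP; split=> L /=; first by move=> [M xM <-];
  rewrite act_set1.
by move=> xL; exists L => //; rewrite act_set1.
Qed.

Lemma act_vertexM g h x : act_vertex (g * h)%g x = act_vertex g (act_vertex h x).
Proof.
apply: vertex_inj; apply/seteqP; split=> L /=.
  by move=> [M xM <-]; rewrite act_setM; exists (act_set h M) => //; exists M.
by move=> [_ [M xM <-] <-]; exists M => //; rewrite act_setM.
Qed.

Lemma vdist_actl g x y : vdist (act_vertex g x) y = vdist x (act_vertex (g^-1)%g y).
Proof. by rewrite -(vdist_act (g^-1)%g) (act_vertexK (mulVg g)). Qed.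

Lemma det2E (A : 'M[K]_2) : \det A = A 0 0 * A 1 1 - A 0 1 * A 1 0.
Proof.
rewrite (expand_det_row _ 0) !big_ord_recl big_ord0 /cofactor !det_mx11 !mxE /=.
have L01 : lift ord0 ord0 = 1 :> 'I_2 by apply: val_inj.
have L10 : lift (lift ord0 ord0) 0 = 0 :> 'I_2 by apply: val_inj.
have L00 : lift 0 0 = 1 :> 'I_2 by apply: val_inj.
rewrite ?L10 ?L01 ?L00 /= ?addn0 ?add0n. by ring.
Qed.

(* The determinant of two vectors of [l *: blat b m] has valuation at least
   2 ord l + m; apply this to the images by g of a basis of [blat a n]. *)
Lemma ord_det_le g a n b m l : l != 0 ->
  act_set g (blat a n) `<=` [set l *: u | u in blat b m] -> 2 * ord l + m <= n.
Proof.
move=> l0 gL; set M := mx_of_SL2 g.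
have /gL/(scale_setP _ _ l0)[] : act_set g (blat a n) (M *m vec a 1).
  by exists (vec a 1) => //; exact: blat_vec.
have /gL/(scale_setP _ _ l0)[] : act_set g (blat a n) (M *m vec (upow K n) 0).
  by exists (vec (upow K n) 0) => //; exact: blat_pi.
rewrite !mxE !big_ord_recl !big_ord0 !mxE /= => f1 f0 e1 e0.
have detM : M 0 0 * M 1 1 - M 0 1 * M 1 0 = 1 by rewrite -det2E /M det_SL2.
have L01 : lift ord0 ord0 = 1 :> 'I_2 by apply: val_inj.
rewrite !L01 !addr0 !mulr0 !addr0 !mulr1 in f1 f0 e1 e0.
have h := vgeB (vgeMr f0 e1) (vgeMr e0 f1).
have : vge m (l^-1 ^+ 2 * upow K n).
  move: h; congr (vge _ _).
  transitivity (l^-1 ^+ 2 * upow K n * (M 0 0 * M 1 1 - M 0 1 * M 1 0));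
    last by rewrite detM mulr1.
  by ring.
rewrite vgeE ?mulf_neq0 ?expf_neq0 ?invr_neq0 ?upow_neq0//.
rewrite ordM ?expf_neq0 ?invr_neq0 ?upow_neq0// expr2 ordM ?invr_neq0// ordV//
  ord_upow; lia.
Qed.

(** The relation between levels is [ord_det_le] for [g] and for its inverse. *)
Lemma act_blat g a n b m : act_vertex g (vtx a n) = vtx b m ->
  exists l, [/\ l != 0, act_set g (blat a n) = [set l *: u | u in blat b m] &
    n = 2 * ord l + m].
Proof.
move=> gv.
have : lattices (vtx b m) (act_set g (blat a n)).
  by rewrite -gv; exists (blat a n) => //; exists 1; rewrite ?oner_neq0// scale_set1.
move=> [l l0 gL]; exists l; split=> //.
have h1 : 2 * ord l + m <= n by apply: (@ord_det_le g a n b m l) => //; rewrite gL.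
have : 2 * ord l^-1 + n <= m.
  apply: (@ord_det_le g^-1%g b m a n); first by rewrite invr_neq0.
  move=> _ [u Lu <-]; exists (l *: (mx_of_SL2 g^-1%g *m u)).
    have : act_set g (blat a n) (l *: u) by rewrite gL; exists u.
    move=> [w Lw wE]; rewrite scalemxAr -wE mulmxA.
    have -> : mx_of_SL2 g^-1%g *m mx_of_SL2 g = 1%:M.
      by rewrite [LHS](congr1 (@mx_of_SL2 K) (mulVg g)).
    by rewrite mul1mx.
  by rewrite scalerA mulVf// scale1r.
by rewrite ordV//; lia.
Qed.

(** By [act_blat] the levels of [x] and its image differ by an even number. *)
Lemma vdist_act_even g x : ~~ odd (vdist x (act_vertex g x)).
Proof.
rewrite {1 2}(vtxE x);
  have [b [m gxE]] := vtx_ex (act_vertex g (vtx (center x) (level x))).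
have [l [_ _ nE]] := act_blat gxE.
have := vdistE (vtx (center x) (level x)) (vtx b m); rewrite gxE !level_vtx; lia.
Qed.

End vertex_distance.

(** * Translation lengths and axes *)

Section axes.
Variable K : localFieldType.
Implicit Types (x y z p q : vertex K) (g h X Y : SL2 K).
Local Open Scope group_scope.
Local Open Scope nat_scope.
Local Notation d := (@vdist K).
Local Notation act := (@act_vertex K).

Lemma displacement_ex g : exists n, `[< exists p, d p (act g p) = n >].
Proof. by exists (d (vtx 0%R 0%R) (act g (vtx 0%R 0%R))); apply/asboolP;
  exists (vtx 0%R 0%R). Qed.

(** The translation length as a natural number; [translation_lengthE] identifies it with the infimum
    over the realisation. *)
Definition ell g : nat := ex_minn (displacement_ex g).

Lemma ell_ex g : exists p, d p (act g p) = ell g.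
Proof. by rewrite /ell; case: ex_minnP => n /asboolP. Qed.

Lemma ell_le g p : ell g <= d p (act g p).
Proof. by rewrite /ell; case: ex_minnP => n _; apply; apply/asboolP; exists p. Qed.

Lemma ell_even g : ~~ odd (ell g).
Proof. by have [p <-] := ell_ex g; exact: vdist_act_even. Qed.

Lemma vdist_actV g p : d p (act g^-1 p) = d p (act g p).
Proof. by rewrite vdistC vdist_actl invgK. Qed.

Lemma ellV g : ell g^-1 = ell g.
Proof.
have [p pE] := ell_ex g; have [q qE] := ell_ex g^-1.
have := ell_le g q; have := ell_le g^-1 p; rewrite -pE -qE !vdist_actV.
by move=> h1 h2; apply/eqP; rewrite eqn_leq h1 h2.
Qed.

Lemma actK g : cancel (act g) (act g^-1).
Proof. exact: act_vertexK (mulVg g). Qed.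

Lemma actKV g : cancel (act g^-1) (act g).
Proof. exact: act_vertexK (mulgV g). Qed.

(* If [p, g p] and [p, g^-1 p] overlap in a segment of length s, then the point of
   [p, g p] at distance s from p is on the axis of g, or s is half of d p (g p)
   and its midpoint is fixed. *)
Lemma ell_sq g p : 0 < ell g ->
  d (act g p) (act g^-1 p) = ell g + d p (act g p).
Proof.
move=> l0; pose gp := act g p; pose ggp := act g gp.
have -> : d (act g p) (act g^-1 p) = d p ggp.
  by rewrite vdistC -(vdist_act g) actKV.
have ev1 := vdist_act_even g p; have ev2 := vdist_act_even (g * g)%g p.
rewrite act_vertexM -/gp -/ggp in ev1 ev2.
have dgg : d ggp gp = d gp p by rewrite vdist_act.
have dpg : d gp p = d p gp by rewrite vdistC.
(* Four-point condition with the image of a vertex [q] of minimal displacement. *)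
have up : d p ggp <= ell g + d p gp.
  have [q qE] := ell_ex g; have := vdist_four p ggp gp (act g q).
  have e1 : d gp (act g q) = d p q by rewrite vdist_act.
  have e2 : d ggp (act g q) = d gp q by rewrite vdist_act.
  have := vdist_triangle gp (act g q) q; have := vdist_triangle p q (act g q).
  rewrite (vdistC (act g q) q) e1 e2 qE dgg dpg; lia.
(* The length of the overlap of the geodesics from [gp] to [p] and to [ggp], cut off at half of
   [d p gp]. In the cut-off case the midpoint [z] is fixed, against [l0]. *)
have [s [sd sE]] : exists s, s <= d p gp /\
    (d p ggp <= d p gp /\ s.*2 = d p gp \/ d p gp < d p ggp /\ s.*2 + d p ggp = (d
      p gp).*2).
  have := vdist_triangle p gp ggp; rewrite (vdistC gp ggp) dgg dpg => t.
  case: (leqP (d p ggp) (d p gp)) => h; first by exists (d p gp)./2; split; lia.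
  by exists (d p gp - (d p ggp)./2); split; lia.
have [z [pz zg]] := vdist_between sd.
have e1 : d (act g z) gp = s by rewrite vdist_act vdistC pz.
have e2 : d (act g z) ggp = d p gp - s by rewrite vdist_act zg.
have := vdist_four z ggp p gp; have := vdist_four z (act g z) ggp gp.
have := ell_le g z; rewrite e1 e2 dgg dpg zg (vdistC z p) pz (vdistC ggp p) -/gp; lia.
Qed.

(* By the four-point condition this makes the four half-trees
   [d q (g p) < d q p], for g = X, Y, and [d q (g p) <= d q p], for g = X^-1, Y^-1,
   pairwise disjoint. *)
Definition schottky X Y p :=
  let m := maxn (d p (act X p)) (d p (act Y p)) in
  [/\ m <= d (act X p) (act Y p), m < d (act X^-1 p) (act Y^-1 p),
      m < d (act X p) (act Y^-1 p) & m < d (act X^-1 p) (act Y p)].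

(* The neighbour z of p towards the axis of X has a smaller displacement by X, hence
   a larger one by Y, so z is on no geodesic from p to Y p or Y^-1 p. *)
Lemma off_axis X Y p : 0 < ell X -> 0 < ell Y -> ell X < d p (act X p) ->
  (forall q, d p (act X p) + d p (act Y p) <= d q (act X q) + d q (act Y q)) ->
  forall a b, a = act X p \/ a = act X^-1 p -> b = act Y p \/ b = act Y^-1 p ->
  d p (act X p) + d p (act Y p) <= d a b.
Proof.
move=> lX lY offX pmin.
have ev := vdist_act_even X p; have evl := ell_even X.
have [|z [pz za]] := @vdist_between _ p (act X p) 1; first lia.
have sq := ell_sq p lX.
(* As [p] is off the axis, [sq] makes the geodesics from [p] to [X p] and to [X^-1 p] share their
   first edge. *)
have za' : d z (act X^-1 p) <= d p (act X p) - 1.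
  have := vdist_four z (act X^-1 p) (act X p) p.
  rewrite (vdistC _ p) za (vdistC (act X^-1 p) p) vdist_actV (vdistC z p) pz.
  by rewrite (vdistC (act X^-1 p)) sq; lia.
have zz : d z (act X z) + 2 <= d p (act X p).
  have := vdist_four z (act X z) p (act X p).
  rewrite vdist_act (vdistC z p) pz za (vdist_actl X z p); lia.
have minz := pmin z.
have zb : d p (act Y p) < d z (act Y p).
  have := vdist_triangle z (act Y p) (act Y z); rewrite vdist_act pz; lia.
have zb' : d p (act Y p) < d z (act Y^-1 p).
  have := vdist_triangle z (act Y^-1 p) (act Y^-1 z);
    rewrite vdist_act pz vdist_actV; lia.
move=> a b aE bE.
have {}bE : d z b > d p (act Y p) /\ d p b = d p (act Y p).
  by case: bE => ->; rewrite ?vdist_actV.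
have {}aE : d z a <= d p (act X p) - 1 /\ d p a = d p (act X p).
  by case: aE => ->; rewrite ?vdist_actV ?za.
(* [z] is one step from [p] towards [a] and away from [b], so the geodesics from [p] to [a] and [b]
   meet only in [p]. *)
have := vdist_four z b p a; rewrite (vdistC z p) pz (vdistC b p) (vdistC b a); lia.
Qed.

(** By [ell_sq] the geodesics from [p] to [X p] and [X^-1 p] meet only in [p], and likewise for Y.
    Each therefore shares an initial edge with at most one geodesic of the other pair; the bound [l]
    says that no edge is shared. *)
Lemma on_axes X Y p : 0 < ell X -> 0 < ell Y ->
  d p (act X p) = ell X -> d p (act Y p) = ell Y ->
  let l := ell X + ell Y in
  l <= d (act X^-1 p) (act Y p) /\ l <= d (act X p) (act Y^-1 p) \/
  l <= d (act X p) (act Y p) /\ l <= d (act X^-1 p) (act Y^-1 p).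
Proof.
move=> lX lY pX pY l; have sX := ell_sq p lX; have sY := ell_sq p lY.
rewrite pX in sX; rewrite pY in sY.
have pX' : d p (act X^-1 p) = ell X by rewrite vdist_actV.
have pY' : d p (act Y^-1 p) = ell Y by rewrite vdist_actV.
have := vdist_four (act X p) (act X^-1 p) (act Y p) p.
have := vdist_four (act X p) (act X^-1 p) (act Y^-1 p) p.
have := vdist_four (act Y p) (act Y^-1 p) (act X p) p.
have := vdist_four (act Y p) (act Y^-1 p) (act X^-1 p) p.
rewrite !(vdistC _ p) pX pX' pY pY' sX sY.
rewrite (vdistC (act Y p) (act X p)) (vdistC (act Y p) (act X^-1 p)).
rewrite (vdistC (act Y^-1 p) (act X p)) (vdistC (act Y^-1 p) (act X^-1 p)) /l; lia.
Qed.

(* p is on both axes, and X and Y translate in the same direction where the axes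
   meet. *)
Definition aligned X Y p :=
  [/\ d p (act X p) = ell X, d p (act Y p) = ell Y,
      ell X + ell Y <= d (act X^-1 p) (act Y p) &
      ell X + ell Y <= d (act X p) (act Y^-1 p)].

Lemma alignedV X Y p : aligned X Y p -> aligned X^-1 Y^-1 p.
Proof. by move=> [h1 h2 h3 h4]; split; rewrite ?ellV ?vdist_actV ?invgK. Qed.

(** The geodesics from [p] to [X p] and [Y p] overlap in half of
    [ell X + ell Y - d (act X p) (act Y p)]. The strict bounds against [maxn] keep this overlap and
    the backward one below both translation lengths. Moving one edge along the overlap shortens it
    by one edge and lengthens the backward one by one. *)
Lemma aligned_step X Y p : 0 < ell X -> 0 < ell Y -> aligned X Y p ->
  maxn (ell X) (ell Y) < d (act X p) (act Y p) + minn (ell X) (ell Y) ->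
  maxn (ell X) (ell Y) < d (act X^-1 p) (act Y^-1 p) + minn (ell X) (ell Y) ->
  d (act X p) (act Y p) < ell X + ell Y ->
  exists z, [/\ aligned X Y z,
    d (act X z) (act Y z) = d (act X p) (act Y p) + 2 &
    d (act X^-1 z) (act Y^-1 z) + 2 = d (act X^-1 p) (act Y^-1 p)].
Proof.
move=> lX lY [pX pY h1 h2] h3 h4 h5.
have evX := ell_even X; have evY := ell_even Y.
have pX' : d p (act X^-1 p) = ell X by rewrite vdist_actV.
have pY' : d p (act Y^-1 p) = ell Y by rewrite vdist_actV.
have par := vdist_parity (act X p) (act Y p) p.
have par' := vdist_parity (act X^-1 p) (act Y^-1 p) p.
rewrite !(vdistC _ p) pX pY in par; rewrite !(vdistC _ p) pX' pY' in par'.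
have sX := ell_sq p lX; have sY := ell_sq p lY; rewrite pX in sX; rewrite pY in sY.
have [|z [pz za]] := @vdist_between _ p (act X p) 1; first lia.
rewrite pX in za.
have zp : d z p = 1 by rewrite vdistC.
have zb : d z (act Y p) = ell Y - 1.
  have := vdist_four z (act Y p) (act X p) p; have := vdist_triangle p z (act Y p).
  rewrite zp pz !(vdistC _ p) pX pY za (vdistC (act Y p)); lia.
have za' : d z (act X^-1 p) = ell X + 1.
  have := vdist_triangle (act X p) z (act X^-1 p);
    have := vdist_triangle z p (act X^-1 p).
  rewrite sX zp pX' (vdistC _ z) za; lia.
have zb' : d z (act Y^-1 p) = ell Y + 1.
  have := vdist_triangle (act Y p) z (act Y^-1 p);
    have := vdist_triangle z p (act Y^-1 p).
  rewrite sY zp pY' (vdistC _ z) zb; lia.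
have XzXp g : d (act g z) (act g p) = 1 by rewrite vdist_act.
have Xzp : d (act X z) p = ell X + 1 by rewrite vdist_actl.
have Yzp : d (act Y z) p = ell Y + 1 by rewrite vdist_actl.
have Xzp' : d (act X^-1 z) p = ell X - 1 by rewrite vdist_actl invgK.
have Yzp' : d (act Y^-1 z) p = ell Y - 1 by rewrite vdist_actl invgK.
have zX : d z (act X z) = ell X.
  have := ell_le X z; have := vdist_triangle z (act X p) (act X z).
  rewrite (vdistC (act X p)) XzXp za; lia.
have zY : d z (act Y z) = ell Y.
  have := ell_le Y z; have := vdist_triangle z (act Y p) (act Y z).
  rewrite (vdistC (act Y p)) XzXp zb; lia.
have XzYp : d (act X z) (act Y p) = d (act X p) (act Y p) + 1.
  have := vdist_four (act X z) p (act X p) (act Y p).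
  have := vdist_triangle (act X z) (act X p) (act Y p).
  rewrite Xzp XzXp pX pY; lia.
have XzYz : d (act X z) (act Y z) = d (act X p) (act Y p) + 2.
  have := vdist_four (act Y z) p (act Y p) (act X z).
  have := vdist_triangle (act X z) (act Y p) (act Y z).
  rewrite (vdistC (act Y p) (act X z)) (vdistC p (act X z)) (vdistC (act Y p) (act
    Y z)).
  rewrite (vdistC (act Y z) (act X z)) XzYp Yzp XzXp Xzp pY; lia.
have XzYp' : d (act X^-1 z) (act Y^-1 p) + 1 = d (act X^-1 p) (act Y^-1 p).
  have := vdist_four (act X^-1 z) (act Y^-1 p) (act X^-1 p) p.
  have := vdist_triangle (act X^-1 p) (act X^-1 z) (act Y^-1 p).
  rewrite (vdistC (act X^-1 p) (act X^-1 z)) (vdistC (act X^-1 p) p) (vdistC (act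
    Y^-1 p) p).
  rewrite (vdistC (act Y^-1 p) (act X^-1 p)) XzXp Xzp' pX' pY'; lia.
have XzYz' : d (act X^-1 z) (act Y^-1 z) + 2 = d (act X^-1 p) (act Y^-1 p).
  have := vdist_four (act Y^-1 z) (act X^-1 z) (act Y^-1 p) p.
  have := vdist_triangle (act X^-1 z) (act Y^-1 z) (act Y^-1 p).
  have := vdist_triangle (act X^-1 p) (act X^-1 z) (act Y^-1 p).
  rewrite (vdistC (act X^-1 p) (act X^-1 z)) (vdistC (act Y^-1 p) p).
  rewrite (vdistC (act Y^-1 z) (act X^-1 z)) !XzXp Xzp' Yzp' pY'; lia.
exists z; split=> //; split=> //; have := on_axes lX lY zX zY.
- have := vdist_triangle (act X^-1 p) p (act Y^-1 p); rewrite (vdistC _ p) pX' pY'; lia.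
- have := vdist_triangle (act X^-1 p) p (act Y^-1 p); rewrite (vdistC _ p) pX' pY'; lia.
Qed.

Lemma aligned_iter X Y p k : 0 < ell X -> 0 < ell Y ->
  (forall q, maxn (ell X) (ell Y) < d (act X q) (act Y q) + minn (ell X) (ell Y)) ->
  (forall q, maxn (ell X) (ell Y) < d (act X^-1 q) (act Y^-1 q) + minn (ell X) (ell
    Y)) ->
  aligned X Y p -> d (act X p) (act Y p) + k.*2 <= ell X + ell Y ->
  exists z, [/\ aligned X Y z,
    d (act X z) (act Y z) = d (act X p) (act Y p) + k.*2 &
    d (act X^-1 z) (act Y^-1 z) + k.*2 = d (act X^-1 p) (act Y^-1 p)].
Proof.
move=> lX lY hf hb ap; elim: k => [|k IH] hk.
  by exists p; split=> //; lia.
have [|z [az zf zb]] := IH; first lia.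
have [|w [aw wf wb]] := aligned_step lX lY az (hf z) (hb z); first lia.
by exists w; split=> //; lia.
Qed.

(* Shifting the base point along the common segment of the axes balances the
   overlaps of its translates by X, Y and by X^-1, Y^-1. *)
Lemma aligned_schottky X Y p : 0 < ell X -> 0 < ell Y ->
  (forall q, maxn (ell X) (ell Y) < d (act X q) (act Y q) + minn (ell X) (ell Y)) ->
  (forall q, maxn (ell X) (ell Y) < d (act X^-1 q) (act Y^-1 q) + minn (ell X) (ell
    Y)) ->
  aligned X Y p -> exists z, schottky X Y z.
Proof.
move=> lX lY hf hb ap.
have evX := ell_even X; have evY := ell_even Y.
have tri q : aligned X Y q -> d (act X q) (act Y q) <= ell X + ell Y /\
    d (act X^-1 q) (act Y^-1 q) <= ell X + ell Y /\ ~~ odd (d (act X q) (act Y q)) /\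
    ~~ odd (d (act X^-1 q) (act Y^-1 q)).
  move=> [qX qY _ _].
  have qX' : d q (act X^-1 q) = ell X by rewrite vdist_actV.
  have qY' : d q (act Y^-1 q) = ell Y by rewrite vdist_actV.
  have := vdist_triangle (act X q) q (act Y q);
    have := vdist_triangle (act X^-1 q) q (act Y^-1 q).
  have := vdist_parity (act X q) q (act Y q);
    have := vdist_parity (act X^-1 q) q (act Y^-1 q).
  rewrite !(vdistC _ q) qX qY qX' qY' (vdistC (act Y q)) (vdistC (act Y^-1 q)); lia.
(* Moving until the forward overlap is exhausted turns the whole common segment into backward
   overlap, to which [hb] applies. The extra 1 comes from parity. *)
have sum q : aligned X Y q -> maxn (ell X) (ell Y) + 1 + (ell X + ell Y) <
    d (act X q) (act Y q) + d (act X^-1 q) (act Y^-1 q) + minn (ell X) (ell Y).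
  move=> aq; have [t1 [t2 [t3 t4]]] := tri q aq.
  have [|z [az zf zb]] := @aligned_iter X Y q (ell X + ell Y - d (act X q) (act Y
    q))./2 lX lY hf hb aq.
    lia.
  by have := hb z; have := tri z az; lia.
have fin q : aligned X Y q -> maxn (ell X) (ell Y) <= d (act X q) (act Y q) ->
    maxn (ell X) (ell Y) < d (act X^-1 q) (act Y^-1 q) -> exists z, schottky X Y z.
  move=> [h1 h2 h3 h4] h5 h6; exists q; rewrite /schottky h1 h2; split=> //; lia.
have [t1 [t2 [t3 t4]]] := tri p ap; have sp := sum p ap.
have [h|h] := ltnP (d (act X p) (act Y p)) (maxn (ell X) (ell Y)).
  (* The forward distance is raised to exactly the maximum, since [schottky] allows equality there;
     [sum] makes the backward one larger. *)
  have [|z [az zf zb]] := @aligned_iter X Y p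
    (maxn (ell X) (ell Y) - d (act X p) (act Y p))./2 lX lY hf hb ap; first lia.
  by apply: (fin z az); lia.
have [h'|h'] := ltnP (maxn (ell X) (ell Y)) (d (act X^-1 p) (act Y^-1 p)).
  exact: (fin p ap).
(* Now the shift goes backwards. The backward inequality is strict and distances change by 2, hence
   the target maximum plus 2. *)
have [||||||z [/alignedV az zf zb]] := @aligned_iter X^-1 Y^-1 p
    (maxn (ell X) (ell Y) + 2 - d (act X^-1 p) (act Y^-1 p))./2; rewrite ?ellV//.
- by move=> q; rewrite !invgK.
- exact: alignedV.
- lia.
rewrite !invgK in az zb; apply: (fin z az); lia.
Qed.

Lemma ell_conj_le X Y p : ell (X * Y)%g <= d (act X^-1 p) (act Y p).
Proof. by rewrite vdist_actl invgK -act_vertexM; exact: ell_le. Qed.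

Lemma ell_conj_le' X Y p : ell (X * Y)%g <= d (act X p) (act Y^-1 p).
Proof.
have := ell_le (X * Y)%g (act Y^-1 p).
by rewrite act_vertexM actKV vdistC.
Qed.

(** Through [k1] to [k4] the hypotheses keep every overlap along a common segment of the axes below
    both translation lengths. Where the axes meet, either X and Y or X and Y^-1 translate in the
    same direction, hence the disjunction. *)
Lemma schottky_ex X Y : 0 < ell X -> 0 < ell Y ->
  maxn (ell X) (ell Y) < ell (X * Y)%g + minn (ell X) (ell Y) ->
  maxn (ell X) (ell Y) < ell (X^-1 * Y)%g + minn (ell X) (ell Y) ->
  exists p, schottky X Y p \/ schottky X Y^-1 p.
Proof.
move=> lX lY h1 h2.
have k1 q := ell_conj_le X Y q; have k2 q := ell_conj_le' X Y q.
have k3 q := ell_conj_le X^-1 Y q; have k4 q := ell_conj_le' X^-1 Y q.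
(* A vertex with minimal sum of displacements lies on both axes or on the bridge between them. *)
have : exists n, `[< exists p, d p (act X p) + d p (act Y p) = n >].
  by have [p _] := ell_ex X; exists (d p (act X p) + d p (act Y p)); apply/asboolP;
    exists p.
case/ex_minnP => n /asboolP[p pE] nmin.
have pmin q : d p (act X p) + d p (act Y p) <= d q (act X q) + d q (act Y q).
  by rewrite pE; apply: nmin; apply/asboolP; exists q.
have off : (forall a b, a = act X p \/ a = act X^-1 p ->
  b = act Y p \/ b = act Y^-1 p ->
  d p (act X p) + d p (act Y p) <= d a b) ->
    exists p, schottky X Y p \/ schottky X Y^-1 p.
  move=> h; exists p; left; rewrite /schottky.
  have := h _ _ (or_introl erefl) (or_introl erefl).
  have := h _ _ (or_introl erefl) (or_intror erefl).
  have := h _ _ (or_intror erefl) (or_introl erefl).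
  have := h _ _ (or_intror erefl) (or_intror erefl).
  by have := ell_le X p; have := ell_le Y p => *; split; lia.
have [hX|hX] := ltnP (ell X) (d p (act X p)).
  by apply: off => a b; exact: off_axis.
have [hY|hY] := ltnP (ell Y) (d p (act Y p)).
  apply: off => a b ha hb; rewrite addnC (vdistC a b); apply: (@off_axis Y X p) => //.
  by move=> q; rewrite addnC [leqRHS]addnC.
have pX : d p (act X p) = ell X by have := ell_le X p; lia.
have pY : d p (act Y p) = ell Y by have := ell_le Y p; lia.
have [[a1 a2]|[a1 a2]] := on_axes lX lY pX pY.
  have [|||z hz] := @aligned_schottky X Y p lX lY; last by exists z; left.
  - by move=> q; apply: leq_trans h2 _; rewrite leq_add2r -[X in act X q]invgK.
  - by move=> q; apply: leq_trans h2 _; rewrite leq_add2r.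
  - by [].
have [||||z hz] := @aligned_schottky X Y^-1 p lX; last by exists z; right.
- by rewrite ellV.
- by move=> q; rewrite ellV; apply: leq_trans h1 _; rewrite leq_add2r.
- by move=> q; rewrite ellV invgK; apply: leq_trans h1 _; rewrite leq_add2r.
by split; rewrite ?ellV ?vdist_actV ?invgK.
Qed.

End axes.

(** * The geometric realisation *)

Section realisation.
Variables (R : realType) (K : localFieldType).
Implicit Types (u w x y z : vertex K) (f : vertex K ->
  R) (p q r : bt_tree R K) (g : SL2 K).

(* The extension of f to the realisation, affine on each edge. *)
Definition affine_ext f (q : bt_tree R K) : R := \sum_(z \in [set: vertex K]) q z * f z.

(** The two summands of [edge_point] are summed separately, so the degenerate case [u = w] needs no
    distinction. *)
Lemma affine_ext_edge f q u w t : barycentric q = edge_point u w t ->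
  affine_ext f q = (1 - t) * f u + t * f w.
Proof.
rewrite /affine_ext => ->.
have sing (c : R) (v : vertex K) (D : set (vertex K)) : D v ->
    \sum_(z \in D) c * (z == v)%:R * f z = c * f v.
  move=> Dv; rewrite -(@fsbig_widen _ _ _ _ [set v]).
  - by rewrite fsbig_set1 eqxx mulr1.
  - by move=> _ ->.
  - by move=> z [_ /eqP/negPf zv] /=; rewrite zv mulr0 mul0r.
rewrite -(@fsbig_widen _ _ _ _ [set u; w])//; last first.
  move=> z [_ /= /not_orP[/eqP/negPf zu /eqP/negPf zw]].
  by rewrite /edge_point zu zw !mulr0 addr0 mul0r.
rewrite (eq_fsbigr (fun z => (1 - t) * (z == u)%:R * f z + t * (z == w)%:R * f z)).
  rewrite fsbig_split//=; first by rewrite !sing//; [right|left].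
by move=> z _; rewrite /edge_point mulrDl.
Qed.

Lemma affine_ext_vertex f x : affine_ext f (vertex_point R x) = f x.
Proof.
rewrite (@affine_ext_edge _ _ x x 0)//; by rewrite subr0 mul1r mul0r addr0.
Qed.

Lemma affine_ext_compl f q : affine_ext (fun z => 1 - f z) q = 1 - affine_ext f q.
Proof.
have [u [w [t [_ _ qE]]]] := barycentricP q.
by rewrite !(affine_ext_edge _ qE); ring.
Qed.

Lemma act_tree_edge g q u w t : barycentric q = edge_point u w t ->
  barycentric (act_tree g q) = edge_point (act_vertex g u) (act_vertex g w) t.
Proof.
move=> qE /=; rewrite qE.
have gE (z x : vertex K) : (act_vertex (g^-1)%g z == x) = (z == act_vertex g x).
  by apply/eqP/eqP => [<-|->]; rewrite ?actK ?actKV.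
by apply/funext => z; rewrite /edge_point /= !gE.
Qed.

Lemma affine_ext_act f g q :
  affine_ext f (act_tree g q) = affine_ext (f \o act_vertex g) q.
Proof.
have [u [w [t [_ _ qE]]]] := barycentricP q.
by rewrite (affine_ext_edge _ qE) (affine_ext_edge _ (act_tree_edge g qE)).
Qed.

Lemma affine_ext_lipschitz f p q (l : R) :
  (forall u w, adjacent u w -> `|f u - f w| <= 1) ->
  pl_path p q l -> `|affine_ext f p - affine_ext f q| <= l.
Proof.
move=> f1; elim=> [{}p|{}p q' {}q k u w s t uw _ _ pE qE _ IH].
  by rewrite subrr normr0.
rewrite -(subrKA (affine_ext f q')); apply: (le_trans (ler_normD _ _)).
apply: lerD => //; rewrite (affine_ext_edge _ pE) (affine_ext_edge _ qE).
rewrite (_ : _ - _ = (t - s) * (f u - f w)); last by ring.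
by rewrite normrM distrC ler_piMr// f1.
Qed.

Lemma bt_tree_inj p q : barycentric p = barycentric q -> p = q.
Proof.
case: p q => [b hb] [c hc] /= bc; subst c.
by congr TreePoint; exact: Prop_irrelevance.
Qed.

Lemma act_tree_vertex g x :
  act_tree g (vertex_point R x) = vertex_point R (act_vertex g x).
Proof. by apply: bt_tree_inj; rewrite (@act_tree_edge g _ x x 0). Qed.

Lemma pl_path_vertices x y : pl_path (vertex_point R x) (vertex_point R y) (vdist x
  y)%:R.
Proof.
move dE : (vdist x y) => d; elim: d x dE => [|d IH] x dE.
  by rewrite (vdist_eq0 dE); exact: pl_path_nil.
have [|z xz zy] := @vdist_step _ x y; first by move=> xy; rewrite xy vdistxx in dE.
have := IH z; rewrite -natr1 addrC (_ : 1 = `|0 - 1| :> R); last first.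
  by rewrite sub0r normrN1.
move=> h; apply: (pl_path_cons xz _ _ _ _ (h _)); rewrite ?lexx ?ler01//; last lia.
all: by apply/funext => v; rewrite /= /edge_point; ring.
Qed.

(** Geodesics bound the infimum from above. From below, the affine extension of the distance to [y]
    changes along any path by at most its length. *)
Lemma tree_dist_vertices x y :
  tree_dist (vertex_point R x) (vertex_point R y) = (vdist x y)%:R%:E.
Proof.
apply/eqP; rewrite eq_le; apply/andP; split.
  by apply: ereal_inf_lbound; exists (vdist x y)%:R => //; exact: pl_path_vertices.
apply/ereal_infP => _ [l xy <-]; rewrite lee_fin.
pose f z : R := (vdist z y)%:R.
have f1 u w : adjacent u w -> `|f u - f w| <= 1.
  move=> /(adjacent_vdist y)[|] e; rewrite /f e -natr1.
    by rewrite addrAC subrr add0r normr1.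
  by rewrite opprD addrA subrr sub0r normrN1.
have := affine_ext_lipschitz f1 xy; rewrite !affine_ext_vertex /f vdistxx subr0.
by rewrite ger0_norm.
Qed.

Lemma translation_lengthE g : translation_length R g = (ell g)%:R%:E.
Proof.
rewrite /translation_length; apply/eqP; rewrite eq_le; apply/andP; split.
  apply: ereal_inf_lbound; have [x xE] := ell_ex g; exists x => //.
  by rewrite act_tree_vertex tree_dist_vertices xE.
apply/ereal_infP => _ [x _ <-].
by rewrite act_tree_vertex tree_dist_vertices lee_fin ler_nat ell_le.
Qed.

(* The points at distance at most 1/2 from the subcomplex spanned by S: what is
   not in it is in the one attached to the complement of S. *)
Definition thicken (S : pred (vertex K)) : set (bt_tree R K) :=
  [set q | 1 / 2 <= affine_ext (fun z => (S z)%:R) q].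

(** A point below the threshold by [e] has no point of the set within distance [e], the extension
    being 1-Lipschitz. *)
Lemma closed_thicken S : closed (thicken S).
Proof.
move=> q clq; rewrite /thicken /= leNgt; apply/negP => lt.
set e := 1 / 2 - affine_ext (fun z => (S z)%:R) q.
have e0 : 0 < e by rewrite subr_gt0.
have [r [Sr]] := clq _ (nbhsx_ballx q e e0).
move=> /ereal_inf_lt[_ [l qr <-]]; rewrite lte_fin => le.
have f1 u w : adjacent u w -> `|(S u)%:R - (S w)%:R : R| <= 1.
  by move=> _; case: (S u); case: (S w);
    rewrite ?subrr ?subr0 ?sub0r ?normrN1 ?normr0 ?normr1 ?ler01.
have := affine_ext_lipschitz f1 qr; rewrite ler_norml => /andP[h _].
move: Sr le h; rewrite /thicken /= /e; lra.
Qed.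

Lemma thicken_vertex S x : thicken S (vertex_point R x) <-> S x.
Proof.
rewrite /thicken /= affine_ext_vertex; case: (S x); split=> //=.
  by move=> _; lra.
by move=> h; exfalso; move: h; lra.
Qed.

(** Pulling the indicator of [T] back along [g] gives one minus that of [S], so a value below 1/2
    becomes one above 1/2. *)
Lemma thicken_act (S T : pred (vertex K)) g :
  (forall z, T (act_vertex g z) = ~~ S z) ->
  act_tree g @` (~` thicken S) `<=` thicken T.
Proof.
move=> TS _ [q /= Sq <-]; rewrite /thicken /= affine_ext_act.
rewrite (_ : _ \o _ = fun z => 1 - (S z)%:R).
  rewrite affine_ext_compl; move/negP: Sq; rewrite -ltNge; lra.
by apply/funext => z /=; rewrite TS; case: (S z); rewrite ?subrr ?subr0.
Qed.

(** No edge meets both [S] and [T], so on each edge one of the two affine functions vanishes. *)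
Lemma thicken_disjoint (S T : pred (vertex K)) :
  (forall z, ~~ (S z && T z)) -> (forall u w, adjacent u w -> S u -> ~~ T w) ->
  thicken S `&` thicken T = set0.
Proof.
move=> ST adjST; apply/seteqP; split=> // q [].
rewrite /thicken /=; have [u [w [t [uw /andP[t0 t1] qE]]]] := barycentricP q.
rewrite !(affine_ext_edge _ qE).
have := ST u; have := ST w.
have uw' : S u -> ~~ T w.
  case: uw => [<- Su|]; last exact: adjST.
  by have := ST u; rewrite Su.
have wu' : S w -> ~~ T u.
  case: uw => [-> Sw|/adjacent_sym]; last exact: adjST.
  by have := ST w; rewrite Sw.
move: uw' wu'; case: (S u); case: (S w); case: (T u); case: (T w) => //=.
all: rewrite ?mulr0 ?mulr1; try (by move=> /(_ isT)); try (by move=> _ /(_ isT)); lra.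
Qed.

End realisation.

(** * Words *)

Section words.
Variable gT : groupType.
Implicit Types (X Y x y h : gT) (a b : bool * bool) (w : seq (bool * bool)) (S H :
  set gT).
Local Open Scope group_scope.

Lemma generated1 S : generated S 1.
Proof. by move=> H [/= [/set_mem]]. Qed.

Lemma generatedM S x y : generated S x -> generated S y -> generated S (x * y).
Proof.
move=> Sx Sy H [/= Hc SH]; have Hx := Sx H (conj Hc SH); have Hy := Sy H (conj Hc SH).
by apply/set_mem; apply: (group_closedM Hc); exact/mem_set.
Qed.

Lemma generatedV S x : generated S x -> generated S x^-1.
Proof.
move=> Sx H [/= Hc SH]; have Hx := Sx H (conj Hc SH).
by apply/set_mem; apply: (group_closedV Hc); exact/mem_set.
Qed.

Lemma generated_sub S H : H 1 -> (forall x y, H x -> H y -> H (x * y)) ->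
  (forall x, H x -> H x^-1) -> S `<=` H -> generated S `<=` H.
Proof.
move=> H1 HM HV SH x; apply; split=> //; split; first exact/mem_set.
by move=> y z /set_mem Hy /set_mem Hz; apply/mem_set/HM => //; exact: HV.
Qed.

Lemma generatedS S T : S `<=` generated T -> generated S `<=` generated T.
Proof.
by apply: generated_sub; [exact: generated1|move=> *; exact: generatedM|move=> *;
  exact: generatedV].
Qed.

Lemma mem_generated S x : S x -> generated S x.
Proof. exact: sub_gen_smallest. Qed.

Lemma generated2_eq X Y x y : generated [set X; Y] x -> generated [set X; Y] y ->
  generated [set x; y] X -> generated [set x; y] Y ->
  generated [set x; y] = generated [set X; Y].
Proof.
by move=> hx hy hX hY; apply/seteqP; split; apply: generatedS => z [->|->].
Qed.

Lemma generated_swap X Y : generated [set X; Y] = generated [set Y; X].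
Proof. by rewrite setUC. Qed.

Lemma generated_mulr X Y : generated [set X; (X * Y)] = generated [set X; Y].
Proof.
have gX : generated [set X; Y] X by apply: mem_generated; left.
have gY : generated [set X; Y] Y by apply: mem_generated; right.
have gX' : generated [set X; (X * Y)] X by apply: mem_generated; left.
have gZ : generated [set X; (X * Y)] (X * Y) by apply: mem_generated; right.
apply: generated2_eq => //; first exact: generatedM.
by have := generatedM (generatedV gX') gZ; rewrite mulKg.
Qed.

Lemma generated_invl X Y : generated [set X^-1; Y] = generated [set X; Y].
Proof.
apply: generated2_eq.
- by apply: generatedV; apply: mem_generated; left.
- by apply: mem_generated; right.
- by rewrite -[X in generated _ X]invgK; apply: generatedV; apply: mem_generated; left.
- by apply: mem_generated; right.
Qed.

Lemma generated_invr X Y : generated [set X; Y^-1] = generated [set X; Y].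
Proof. by rewrite [RHS]generated_swap -generated_invl; exact: generated_swap. Qed.

(** Centralisers are subgroups: use first those of X and Y, then that of [x]. *)
Lemma generated_commute X Y x y : commute X Y ->
  generated [set X; Y] x -> generated [set X; Y] y -> commute x y.
Proof.
move=> XY Gx Gy.
have cen z : commute z X -> commute z Y -> generated [set X;
  Y] `<=` [set h | commute z h].
  move=> zX zY; apply: generated_sub => /=.
  - exact: commute1.
  - by move=> u v; exact: commuteM.
  - by move=> u; exact: commuteV.
  - by move=> u [->|->].
apply: (cen x _ _ y Gy).
- by apply: commute_sym; apply: (cen X _ _ x Gx).
- by apply: commute_sym; apply: (cen Y _ _ x Gx) => //; exact: commute_sym.
Qed.

Definition inv_letter a := (a.1, ~~ a.2).

Lemma inv_letterK : involutive inv_letter.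
Proof. by case=> i e; rewrite /inv_letter /= negbK. Qed.

Lemma inv_letter_neq a : inv_letter a != a.
Proof. by case: a => i []; rewrite xpair_eqE eqxx. Qed.

Lemma letterV X Y a : letter X Y (inv_letter a) = (letter X Y a)^-1.
Proof. by case: a => i []; rewrite /letter /= ?invgK. Qed.

Lemma reduced_rel a b : ~~ ((a.1 == b.1) && (a.2 != b.2)) = (b != inv_letter a).
Proof. by case: a b => [[] []] [[] []]. Qed.

Lemma reduced_cons a b w :
  reduced (a :: b :: w) = (b != inv_letter a) && reduced (b :: w).
Proof. by rewrite /reduced /= reduced_rel. Qed.

Lemma reduced_behead a w : reduced (a :: w) -> reduced w.
Proof. by case: w => // b w; rewrite reduced_cons => /andP[]. Qed.

Lemma word_val_nil X Y : word_val X Y [::] = 1.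
Proof. by rewrite /word_val big_nil. Qed.

Lemma word_val_cons X Y a w : word_val X Y (a :: w) = letter X Y a * word_val X Y w.
Proof. by rewrite /word_val big_cons. Qed.

Lemma word_val_cat X Y w1 w2 :
  word_val X Y (w1 ++ w2) = word_val X Y w1 * word_val X Y w2.
Proof. by rewrite /word_val big_cat. Qed.

Lemma reduced_letterM X Y a w : reduced w ->
  exists2 w', reduced w' & word_val X Y w' = letter X Y a * word_val X Y w.
Proof.
case: w => [_|b w rw]; first by exists [:: a]; rewrite ?word_val_cons.
have [bE|ne] := eqVneq b (inv_letter a).
  exists w; first exact: reduced_behead rw.
  by rewrite word_val_cons bE letterV mulVKg.
by exists (a :: b :: w); rewrite ?reduced_cons ?ne// !word_val_cons.
Qed.

Lemma generated_reduced X Y h : generated [set X; Y] h ->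
  exists2 w, reduced w & word_val X Y w = h.
Proof.
suff sub : generated [set X; Y] `<=` [set h | exists w, word_val X Y w = h].
  move=> /sub[w <-]; elim: w => [|a w [w' rw' wE]]; first by exists [::].
  by rewrite word_val_cons -wE; exact: reduced_letterM.
apply: generated_sub => /=.
- by exists [::]; rewrite word_val_nil.
- by move=> x y [w1 <-] [w2 <-]; exists (w1 ++ w2); rewrite word_val_cat.
- move=> x [w <-]; elim: w => [|a w [w' w'E]].
    by exists [::]; rewrite word_val_nil invg1.
  exists (w' ++ [:: inv_letter a]).
  by rewrite word_val_cat w'E !word_val_cons word_val_nil mulg1 invgM letterV.
- by move=> x [->|->]; [exists [:: (false, false)]|exists [:: (true, false)]];
    rewrite word_val_cons word_val_nil mulg1.
Qed.

Lemma generated_free X Y :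
  (forall w1 w2, reduced w1 -> reduced w2 -> word_val X Y w1 = word_val X Y w2 ->
    w1 = w2) ->
  free_of_rank_two (generated [set X; Y]).
Proof.
move=> inj; exists X, Y; split.
- by apply: mem_generated; left.
- by apply: mem_generated; right.
move=> h /generated_reduced[w rw wh]; exists w; split=> // w' [rw' w'h].
by apply: inj => //; rewrite wh w'h.
Qed.

(** Commuting free generators would give their product two reduced words. *)
Lemma free_noncommutative H : free_of_rank_two H -> (forall x y, H x -> H y ->
  H (x * y)) ->
  exists x y, [/\ H x, H y & ~ commute x y].
Proof.
move=> [X [Y [HX HY free]]] HM; exists X, Y; split=> // XY.
have [w [_ uniq]] := free _ (HM _ _ HX HY).
have e1 : w = [:: (false, false); (true, false)].
  by apply: uniq; split=> //; rewrite !word_val_cons word_val_nil mulg1.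
have : w = [:: (true, false); (false, false)].
  by apply: uniq; split=> //; rewrite !word_val_cons word_val_nil mulg1 XY.
by rewrite e1.
Qed.

(** * Free groups are torsion-free *)

Section torsion.
Variables (X Y : gT).
Hypothesis trivial_word : forall w, reduced w -> word_val X Y w = 1 -> w = [::].

Let r := fun a b : bool * bool => ~~ ((a.1 == b.1) && (a.2 != b.2)).

Lemma path_nseq a s b n : path r a s -> r (last a s) a -> r b a ->
  path r b (flatten (nseq n (a :: s))).
Proof.
move=> pas las; elim: n b => //= n IH b ba.
by rewrite ba cat_path pas IH.
Qed.

Lemma word_val_nseq w n : word_val X Y (flatten (nseq n w)) = word_val X Y w ^+ n.
Proof.
by elim: n => [|n IH]; rewrite ?word_val_nil// /= word_val_cat IH expgS.
Qed.

(** Powers of a cyclically reduced word are reduced. Any other word is a conjugate of a shorter one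
    by its first letter, whence the induction on length. *)
Lemma word_torsion_free w n : reduced w -> word_val X Y w ^+ n.+1 = 1 -> w = [::].
Proof.
have [k] := ubnP (size w); elim: k w => // k IH [//|a s] sk rw wn.
have [cyc|] := boolP (r (last a s) a).
  have rr : reduced (flatten (nseq n.+1 (a :: s))).
    by rewrite /reduced /= cat_path [path _ a s]rw path_nseq.
  by have := trivial_word rr; rewrite word_val_nseq => /(_ wn).
rewrite {1}/r reduced_rel negbK => /eqP aE; exfalso.
case/lastP: s => [|s b] in sk rw wn aE; first by have := inv_letter_neq a;
  rewrite -aE eqxx.
rewrite last_rcons in aE.
have bE : b = inv_letter a by rewrite aE inv_letterK.
have rs : reduced s.
  by move: rw; rewrite /reduced /= rcons_path => /andP[/path_sorted].
have sE : s = [::].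
  apply: IH rs _; first by move: sk; rewrite /= size_rcons => /ltnW.
  apply: (can_inj (mulgK (letter X Y a)^-1)); rewrite mul1g.
  apply: (can_inj (mulKg (letter X Y a))); rewrite mulgV mulgA -wn bE.
  rewrite word_val_cons -cats1 word_val_cat word_val_cons word_val_nil mulg1 letterV.
  elim: n.+1 => [|m IHm]; first by rewrite !expg0 mulg1 mulgV.
  by rewrite !expgS -IHm !mulgA mulgVK.
by move: rw; rewrite sE bE [rcons _ _]/= reduced_cons eqxx.
Qed.

End torsion.

Lemma free_torsion_free H h n : free_of_rank_two H -> H 1 -> H h ->
  h ^+ n.+1 = 1 -> h = 1.
Proof.
move=> [X [Y [_ _ free]]] H1 Hh hn.
have [w [[rw wh] _]] := free _ Hh; rewrite -wh.
rewrite (@word_torsion_free X Y _ w n) ?word_val_nil ?wh// => v rv v1.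
have [v' [_ uniq]] := free _ H1.
by rewrite -(uniq v)// -(uniq [::])// word_val_nil.
Qed.

End words.

(** * Ping-pong *)

Section ping_pong.
Variable K : localFieldType.
Implicit Types (x y z p q : vertex K) (X Y g : SL2 K) (a b : bool * bool).
Local Open Scope nat_scope.

(** The term [~~ a.2] makes the inequality strict exactly for uninverted letters; ties thus go to
    the inverse, and [side_act] holds even at vertices equidistant from [p] and its translate. *)
Definition side X Y p a : pred (vertex K) := fun z =>
  vdist z (act_vertex (letter X Y a) p) + ~~ a.2 <= vdist z p.

Lemma side_act X Y p a z :
  side X Y p a (act_vertex (letter X Y a) z) = ~~ side X Y p (inv_letter a) z.
Proof.
rewrite /side vdist_act vdist_actl letterV /= -ltnNge.
by case: a.2; rewrite ?addn0 ?addn1.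
Qed.

Lemma vdist_letter X Y p a : vdist p (act_vertex (letter X Y a) p) =
  vdist p (act_vertex (if a.1 then Y else X) p).
Proof. by case: a => -[] [] //; rewrite /letter /= vdist_actV. Qed.

(** * Half-trees of a Schottky pair *)

Section schottky.
Variables (X Y : SL2 K) (p : vertex K).
Hypotheses (lX : 0 < ell X) (lY : 0 < ell Y) (XYp : schottky X Y p).

Lemma vdist_letter_gt0 a : 0 < vdist p (act_vertex (letter X Y a) p).
Proof.
rewrite vdist_letter; case: a.1; last exact: leq_trans lX (ell_le _ _).
exact: leq_trans lY (ell_le _ _).
Qed.

Lemma side_base a : ~~ side X Y p a p.
Proof. by rewrite /side vdistxx -ltnNge ltn_addr// vdist_letter_gt0. Qed.

Lemma side_letter a : side X Y p a (act_vertex (letter X Y a) p).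
Proof. by rewrite side_act side_base. Qed.

(** For letters of different generators this is [schottky], for a letter and its inverse [ell_sq].
    The tie terms absorb the weak inequality of [schottky], which concerns the two uninverted
    letters. *)
Lemma side_far a b : a != b ->
  vdist p (act_vertex (letter X Y a) p) <
    vdist (act_vertex (letter X Y a) p) (act_vertex (letter X Y b) p) + ~~ b.2 /\
  vdist p (act_vertex (letter X Y b) p) <
    vdist (act_vertex (letter X Y a) p) (act_vertex (letter X Y b) p) + ~~ a.2.
Proof.
pose P i e := act_vertex (letter X Y (i, e)) p.
have [h1 h2 h3 h4] : schottky X Y p := XYp.
have sX : vdist (P false false) (P false true) = ell X + vdist p (P false false).
  exact: ell_sq.
have sY : vdist (P true false) (P true true) = ell Y + vdist p (P true false).
  exact: ell_sq.
have eX : vdist p (P false true) = vdist p (P false false) by exact: vdist_actV.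
have eY : vdist p (P true true) = vdist p (P true false) by exact: vdist_actV.
have sym i e j f : vdist (P i e) (P j f) = vdist (P j f) (P i e) by rewrite vdistC.
rewrite -[act_vertex X p]/(P false false) -[act_vertex Y p]/(P true false) in h1 h2
  h3 h4.
rewrite -[act_vertex Y^-1%g p]/(P true true) in h2 h3.
rewrite -[act_vertex X^-1%g p]/(P false true) in h2 h4.
have s1 := sym true false false false; have s2 := sym true false false true.
have s3 := sym true true false false; have s4 := sym true true false true.
have s5 := sym true true true false; have s6 := sym false true false false.
case: a b => [i e] [j f] ab; rewrite -/(P i e) -/(P j f) /=.
by case: i e j f ab => [] [] [] [] // _; split; rewrite ?eX ?eY /=; lia.
Qed.

(** By the four-point condition, a common [z] would bring the two translates of [p] closer together
    than [side_far] allows. *)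
Lemma side_disjoint a b z : a != b -> ~~ (side X Y p a z && side X Y p b z).
Proof.
move=> /side_far[far1 far2]; apply/negP => /andP[]; rewrite /side.
have := vdist_four (act_vertex (letter X Y a) p) (act_vertex (letter X Y b) p) z p.
rewrite !(vdistC _ z) !(vdistC _ p); lia.
Qed.

(** Distances change by exactly one along an edge, so an edge leaving a half-tree leads towards [p]
    and an edge entering one leads away from [p]. *)
Lemma side_not_adjacent a b x y : a != b -> adjacent x y -> side X Y p a x ->
  ~~ side X Y p b y.
Proof.
move=> ab xy ax; apply/negP => bY.
have xp := adjacent_vdist p xy.
have := side_disjoint x ab; have := side_disjoint y ab; rewrite ax bY /= andbT.
have xa := adjacent_vdist (act_vertex (letter X Y a) p) xy.
have xb := adjacent_vdist (act_vertex (letter X Y b) p) xy.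
by move: ax bY; rewrite /side; lia.
Qed.

Lemma side_word a w : reduced (a :: w) ->
  side X Y p a (act_vertex (word_val X Y (a :: w)) p).
Proof.
elim: w a => [|b w IH] a; first by rewrite word_val_cons word_val_nil mulg1 side_letter.
rewrite reduced_cons => /andP[ba /IH bw].
rewrite word_val_cons act_vertexM side_act.
by have := side_disjoint (act_vertex (word_val X Y (b :: w)) p) ba; rewrite bw.
Qed.

(** The half-tree containing the translate of [p] reveals the first letter of the word, and [p]
    itself lies in none. *)
Lemma word_val_inj w1 w2 : reduced w1 -> reduced w2 ->
  word_val X Y w1 = word_val X Y w2 -> w1 = w2.
Proof.
elim: w1 w2 => [|a w1 IH] [|b w2] // r1 r2 e.
- by have := side_word r2; rewrite -e word_val_nil act_vertex1 (negPf (side_base _)).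
- by have := side_word r1; rewrite e word_val_nil act_vertex1 (negPf (side_base _)).
have [ab|ab] := eqVneq a b; last first.
  have := side_disjoint (act_vertex (word_val X Y (a :: w1)) p) ab.
  by rewrite side_word// e side_word.
rewrite ab; congr cons; apply: IH; [exact: reduced_behead r1|exact: reduced_behead r2|].
by move: e; rewrite !word_val_cons ab => /mulgI.
Qed.

Lemma schottky_free : free_of_rank_two (generated [set X; Y]).
Proof. by apply: generated_free; exact: word_val_inj. Qed.

Lemma schottky_trivial_stabilizer g : generated [set X; Y] g ->
  act_vertex g p = p -> g = 1%g.
Proof.
move=> /generated_reduced[[|a w] rw <-]; first by rewrite word_val_nil.
by move=> e; have := side_word rw; rewrite e (negPf (side_base _)).
Qed.

Lemma schottky_ping_pong (R : realType) : ping_pong R X Y.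
Proof.
pose U a : set (bt_tree R K) := thicken (side X Y p a).
exists (U (false, false)), (U (false, true)), (U (true, false)), (U (true, true)).
have U0 a : U a !=set0.
  by exists (vertex_point R (act_vertex (letter X Y a) p)); apply/thicken_vertex;
    exact: side_letter.
have Udisj a b : a != b -> U a `&` U b = set0.
  move=> ab; apply: thicken_disjoint => [z|x y xy]; first exact: side_disjoint.
  exact: side_not_adjacent.
have Uact a : act_tree (letter X Y a) @` (~` U (inv_letter a)) `<=` U a.
  by apply: thicken_act => z; exact: side_act.
split.
- by split; exact: U0.
- by split; exact: closed_thicken.
- by split; split; exact: Udisj.
- move=> UT; have : [set: bt_tree R K] (vertex_point R p) by [].
  by rewrite -UT => -[[[|]|]|] /thicken_vertex; rewrite (negPf (side_base _)).
- by split; [exact: (Uact (false, false))|exact: (Uact (false, true))|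
             exact: (Uact (true, false))|exact: (Uact (true, true))].
Qed.

End schottky.

Lemma ping_pongV (R : realType) X Y : ping_pong R X Y^-1%g -> ping_pong R X Y.
Proof.
move=> [Up [Um [Vp [Vm [[h1 h2 h3 h4] [h5 h6 h7 h8] [[h9 h10 h11] [h12 h13 h14]]
  h15 [h16 h17 h18 h19]]]]]].
exists Up, Um, Vm, Vp; split=> //.
- by split=> //; split=> //; rewrite setIC.
- by rewrite -setUA [Vm `|` _]setUC setUA.
- by split=> //; rewrite -[Y]invgK.
Qed.

End ping_pong.

(** * Discreteness *)

Section discreteness.
Variable K : localFieldType.
Implicit Types (a x y : K) (n m c N : int) (g h : SL2 K) (p q : vertex K).

Definition mx_vge n k l (A : 'M[K]_(k, l)) := forall i j, vge n (A i j).

Lemma mx_vgeM n m k l r (A : 'M[K]_(k, l)) (B : 'M[K]_(l, r)) :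
  mx_vge n A -> mx_vge m B -> mx_vge (n + m) (A *m B).
Proof.
move=> hA hB i j; rewrite mxE; apply: (big_ind (vge (n + m))).
- exact: vge0.
- by move=> *; exact: vgeD.
- by move=> *; exact: vgeM.
Qed.

Lemma mx_mulVg g : mx_of_SL2 g^-1%g *m mx_of_SL2 g = 1%:M.
Proof. exact: (congr1 (@mx_of_SL2 K) (mulVg g)). Qed.

Lemma mx_mulgV g : mx_of_SL2 g *m mx_of_SL2 g^-1%g = 1%:M.
Proof. exact: (congr1 (@mx_of_SL2 K) (mulgV g)). Qed.

Lemma ord2P (P : 'I_2 -> Prop) : P 0 -> P 1 -> forall i, P i.
Proof.
move=> P0 P1 [[|[|//]] Hi].
- by rewrite (_ : Ordinal Hi = 0)//; apply: val_inj.
- by rewrite (_ : Ordinal Hi = 1)//; apply: val_inj.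
Qed.

Lemma mx_vge_ex k l (A : 'M[K]_(k, l)) : exists c, mx_vge c A.
Proof.
have [f fP] := choice (fun ij : 'I_k * 'I_l => vge_exists (A ij.1 ij.2)).
exists (\big[Num.min/0]_ij f ij) => i j.
by apply: vgeW (fP (i, j)); exact: bigmin_le_cond.
Qed.

(** * Topology in terms of congruences *)

Lemma nbhs_vgeP x (A : set K) : nbhs x A <-> exists n, forall y, vge n (x - y) -> A y.
Proof.
rewrite -nbhs_entourageE; split.
  move=> [E]; rewrite entourage_valuation /= => -[n nE] EA; exists n => y xy.
  by apply: EA; apply/xsectionP; exact: nE.
move=> [n nA]; exists [set xy | vge n (xy.1 - xy.2)].
  by rewrite entourage_valuation; exists n.
by move=> y /xsectionP; exact: nA.
Qed.

Lemma nbhs_mx_vgeP (M : 'M[K]_2) (A : set 'M[K]_2) :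
  nbhs M A <-> exists n, forall M', mx_vge n (M - M') -> A M'.
Proof.
split.
  move=> [P MP PA].
  have {}MP i j : exists n, forall y, vge n (M i j - y) -> P i j y.
    by apply/nbhs_vgeP; exact: MP.
  have [f fP] := choice (fun ij : 'I_2 * 'I_2 => MP ij.1 ij.2).
  exists (\big[Num.max/0]_ij f ij) => M' MM'; apply: PA => i j; apply: (fP (i, j)).
  have := MM' i j; rewrite !mxE; apply: vgeW.
  exact: (@le_bigmax_cond _ _ _ _ (i, j)).
move=> [n nA]; exists (fun i j => [set y | vge n (M i j - y)]).
  by move=> i j; apply/nbhs_vgeP; exists n.
by move=> M' MM'; apply: nA => i j; rewrite !mxE; exact: MM'.
Qed.

Lemma discrete_subgroup_vge (H : set (SL2 K)) : discrete_subgroup H -> H 1%g ->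
  exists N, forall g, H g -> mx_vge N (1%:M - mx_of_SL2 g) -> g = 1%g.
Proof.
move=> disc H1; pose o : H := exist _ 1%g (mem_set H1).
have [A [B oB <-] AE] := disc [set o].
have B1 : B 1%:M.
  have : (set_val @^-1` (set_val @^-1` B)) o by rewrite AE.
  by [].
have /nbhs_mx_vgeP[N hN] : nbhs (1%:M : 'M[K]_2) B by exact: open_nbhs_nbhs.
exists N => g Hg /hN Bg; pose g' : H := exist _ g (mem_set Hg).
have : [set o] g' by rewrite -AE.
by move=> /(congr1 val).
Qed.

Lemma vge_discrete_subgroup (H : set (SL2 K)) N :
  (forall g h, H g -> H h -> H (g^-1 * h)%g) ->
  (forall g, H g -> mx_vge N (1%:M - mx_of_SL2 g) -> g = 1%g) -> discrete_subgroup H.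
Proof.
move=> HM hN U.
(* Translation to the identity multiplies by the inverse of [h], whose entries have valuation at
   least [c]; hence the radius [N - c]. *)
have near (h : SL2 K) : exists n, forall g, H h -> H g ->
    mx_vge n (mx_of_SL2 h - mx_of_SL2 g) -> g = h.
  have [c hc] := mx_vge_ex (mx_of_SL2 h^-1%g).
  exists (N - c) => g Hh Hg hg.
  have : (h^-1 * g)%g = 1%g.
    apply: hN; first exact: HM.
    have -> : 1%:M - mx_of_SL2 (h^-1 * g)%g =
        mx_of_SL2 h^-1%g *m (mx_of_SL2 h - mx_of_SL2 g).
      by rewrite mulmxBr mx_mulVg.
    by have := mx_vgeM hc hg; rewrite subrKC.
  by move=> e; rewrite -[g](mulVKg h) e mulg1.
have [f fP] := choice near.
pose B := [set M : 'M[K]_2 | exists2 h : H, U h &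
  mx_vge (f (val h)) (mx_of_SL2 (val h) - M)].
have oB : open B.
  rewrite openE => M [h Uh hM]; apply/nbhs_mx_vgeP; exists (f (val h)) => M' MM'.
  exists h => // i j; have := vgeD (hM i j) (MM' i j).
  by rewrite !mxE addrA subrK.
exists (set_val @^-1` B); first by exists B.
apply/seteqP; split=> [g [h Uh hg]|g Ug].
  suff -> : g = h by [].
  apply: val_inj; apply: fP (hg); apply/set_mem; exact: valP.
by exists g => // i j; rewrite !mxE subrr vge0.
Qed.

(** * Vertex stabilisers are open and bounded *)

Lemma blat_vge a n : exists c, forall u, blat a n u -> mx_vge c u.
Proof.
have [ca hca] := vge_exists a.
exists (Num.min 0 (Num.min n ca)) => u [u1 u0] i j; rewrite (fintype.ord1 j).
elim/ord2P: i; last by apply: vgeW u1; rewrite ge_min lexx.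
rewrite -(subrK (a * u 1 0) (u 0 0)); apply: vgeD.
  by apply: vgeW u0; rewrite !ge_min lexx orbT.
by apply: vgeW (vgeMr hca u1); rewrite !ge_min lexx !orbT.
Qed.

Lemma vge_blat a n : exists c, forall u : 'cV[K]_2, mx_vge c u -> blat a n u.
Proof.
have [ca hca] := vge_exists a.
exists (Num.max 0 (Num.max n (n - ca))) => u hu; split.
  by apply: vgeW (hu 1 0); rewrite le_max lexx.
apply: vgeB; first by apply: vgeW (hu 0 0); rewrite !le_max lexx orbT.
by apply: vgeW (vgeM hca (hu 1 0)); lia.
Qed.

(** Equal levels force the homothety factor to be a unit, so [g] preserves the lattice itself and
    not only its class. *)
Lemma act_blat_fix g a n : act_vertex g (vtx a n) = vtx a n ->
  forall u, blat a n u -> blat a n (mx_of_SL2 g *m u).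
Proof.
move=> /act_blat[l [l0 gL nE]] u Lu.
have : act_set g (blat a n) (mx_of_SL2 g *m u) by exists u.
have ol : ord l^-1 = 0 by rewrite ordV//; lia.
rewrite gL; move: (_ *m u) => w /(scale_setP _ _ l0)[]; rewrite !mxE => h1 h0; split.
  by move: h1; rewrite mulrC vge_mulr ?invr_neq0// ol.
move: h0; rewrite (_ : _ - _ = (w 0 0 - a * w 1 0) * l^-1); last by ring.
by rewrite vge_mulr ?invr_neq0// ol subr0.
Qed.

Lemma act_blat_stable g a n :
  (forall u, blat a n u -> blat a n (mx_of_SL2 g *m u)) ->
  (forall u, blat a n u -> blat a n (mx_of_SL2 g^-1%g *m u)) ->
  act_vertex g (vtx a n) = vtx a n.
Proof.
move=> h1 h2; apply: (@lattice_vtx _ _ 1); first exact: oner_neq0.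
exists (blat a n); first by exists 1; rewrite ?oner_neq0// scale_set1.
rewrite scale_set1; apply/seteqP; split=> u; first by move=> [w /h1 Lw <-].
move=> Lu; exists (mx_of_SL2 g^-1%g *m u); first exact: h2.
by rewrite mulmxA mx_mulgV mul1mx.
Qed.

Lemma SL2_invE g : mx_of_SL2 g^-1%g = \adj (mx_of_SL2 g).
Proof.
by rewrite -[RHS]mul1mx -(mx_mulVg g) -mulmxA mul_mx_adj det_SL2 mulmx1.
Qed.

(** The inverse is the adjugate, with the same entries up to sign and place, so no precision is
    lost. *)
Lemma SL2_inv_vge N g : mx_vge N (1%:M - mx_of_SL2 g) ->
  mx_vge N (1%:M - mx_of_SL2 g^-1%g).
Proof.
move=> hg; rewrite SL2_invE.
have L10 : lift 1 0 = 0 :> 'I_2 by apply: val_inj.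
have L00 : lift 0 0 = 1 :> 'I_2 by apply: val_inj.
have := hg 0 0; have := hg 0 1; have := hg 1 0; have := hg 1 1.
rewrite !mxE /= => h11 h10 h01 h00 i j; elim/ord2P: i; elim/ord2P: j;
  rewrite !mxE /cofactor det_mx11 !mxE ?L10 ?L00 /= ?expr0 ?expr1 ?expr2 ?mul1r
    ?mulN1r ?opprK ?mul1r//.
all: by rewrite -vgeN opprD oppr0.
Qed.

(** For [g] close to 1, [1 - g] maps the lattice into itself, hence so does [g]; the same applies to
    its inverse. *)
Lemma stabilizer_vge p : exists N, forall g,
  mx_vge N (1%:M - mx_of_SL2 g) -> act_vertex g p = p.
Proof.
have [a [n ->]] := vtx_ex p.
have [c hc] := blat_vge a n; have [m hm] := vge_blat a n.
exists (m - c).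
have stable g : mx_vge (m - c) (1%:M - mx_of_SL2 g) -> forall u, blat a n u ->
  blat a n (mx_of_SL2 g *m u).
  move=> hg u Lu; have := mx_vgeM hg (hc u Lu); rewrite subrK mulmxBl mul1mx => /hm.
  move: Lu => [u1 u0] [w1 w0]; split.
    by have := vgeB u1 w1; rewrite !mxE subKr.
  by have := vgeB u0 w0; rewrite !mxE; congr (vge _ _); ring.
move=> g hg; apply: act_blat_stable; first exact: stable.
by apply: stable; exact: SL2_inv_vge.
Qed.

(** The columns of [g] are combinations of the images of the two basis vectors, which stay in the
    lattice. *)
Lemma stabilizer_bounded p : exists c, forall g, act_vertex g p = p ->
  mx_vge c (mx_of_SL2 g).
Proof.
have [a [n ->]] := vtx_ex p.
have [c hc] := blat_vge a n; have [ca hca] := vge_exists a.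
exists (Num.min (c - n) (Num.min c (c - n + ca))) => g /act_blat_fix gL i.
have h0 : vge (c - n) (mx_of_SL2 g i 0).
  have := hc _ (gL _ (blat_pi a n)) i 0.
  rewrite mxE !big_ord_recl big_ord0 !mxE /= mulr0 !addr0.
  by rewrite vge_mulr ?upow_neq0// ord_upow.
have h1 : vge (Num.min c (c - n + ca)) (mx_of_SL2 g i 1).
  have := hc _ (gL _ (blat_vec a n)) i 0.
  rewrite mxE !big_ord_recl big_ord0 !mxE /= addr0 mulr1.
  have -> : lift ord0 ord0 = 1 :> 'I_2 by apply: val_inj.
  move=> h; rewrite -(addKr (mx_of_SL2 g i 0 * a) (mx_of_SL2 g i 1)) [X in vge _
    X]addrC.
  by apply: vgeB; [apply: vgeW h|apply: vgeW (vgeM h0 hca)]; rewrite ge_min lexx ?orbT.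
by elim/ord2P; [apply: vgeW h0|apply: vgeW h1]; rewrite ge_min lexx ?orbT.
Qed.

(** * Finiteness modulo powers of the uniformiser *)

Lemma residues1 : exists s : seq K, forall x, vge 0 x ->
  exists2 r, r \in s & vge 1 (x - r).
Proof.
have /finite_seqP[t tE] := residue_field_finite (s := K).
exists [seq xget 0 C | C : set K <- t] => x Ox.
pose C : set K := [set y | vge 1 (y - x)].
have Ct : C \in t.
  have : [set` t] C by rewrite -tE; exists x.
  by [].
exists (xget 0 C); first exact: map_f.
have : C (xget 0 C) by apply: (@xgetPex _ 0 C); exists x; rewrite /C /= subrr vge0.
by rewrite /C /= -vgeN opprB.
Qed.

(** Digit by digit: each step adds a residue times the next power of the uniformiser. Using
    [|N - c|] digits also covers the case of [N] below [c]. *)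
Lemma residues c N : exists s : seq K, forall x, vge c x ->
  exists2 r, r \in s & vge N (x - r).
Proof.
suff [s hs] : exists s : seq K, forall x, vge c x ->
    exists2 r, r \in s & vge (c + `|N - c|%N%:Z) (x - r).
  by exists s => x /hs[r rs xr]; exists r => //; apply: vgeW xr; lia.
have [s1 hs1] := residues1.
elim: `|N - c|%N => [|k [s hs]].
  exists [:: 0] => x cx; exists 0; first by rewrite inE.
  by rewrite !subr0.
pose e := upow K (c + k%:Z).
have e0 : e != 0 by exact: upow_neq0.
exists [seq r + e * r' | r <- s, r' <- s1] => x /hs[r rs xr].
have [|r' rs' xr'] := hs1 ((x - r) / e); first by rewrite vge_div// ord_upow add0r.
exists (r + e * r'); first by apply/allpairsP; exists (r, r').
rewrite (_ : x - _ = ((x - r) / e - r') * e); last by field.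
by rewrite vge_mulr// ord_upow; apply: vgeW xr'; lia.
Qed.

Lemma mx_pigeonhole c N (M : nat -> 'M[K]_2) : (forall k, mx_vge c (M k)) ->
  exists i j, (i < j)%N /\ mx_vge N (M i - M j).
Proof.
move=> Mc; have [s hs] := residues c N.
pose code x : 'I_(size s).+1 := inord (find (fun r => vge N (x - r)) s).
have codeP x y : vge c x -> vge c y -> code x = code y -> vge N (x - y).
  move=> /hs[r rs xr] /hs[r' rs' yr'] /(congr1 val).
  rewrite /= !inordK ?ltnS ?find_size// => e.
  have h1 : has (fun r => vge N (x - r)) s by apply/hasP; exists r.
  have h2 : has (fun r => vge N (y - r)) s by apply/hasP; exists r'.
  have := vgeB (nth_find 0 h1) (nth_find 0 h2).
  by rewrite e opprB addrA subrK.
pose f (k : 'I_#|'M['I_(size s).+1]_2|.+1) := map_mx code (M k).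
have /injectivePn[i [j ij fij]] : ~~ injectiveb f.
  by apply/negP => /injectiveP /leq_card; rewrite card_ord ltnn.
have Nij : mx_vge N (M i - M j).
  move=> k l; rewrite !mxE; apply: codeP; [exact: Mc|exact: Mc|].
  by have /matrixP/(_ k l) := fij; rewrite /f !mxE.
have [lt|lt|/val_inj/eqP] := ltngtP i j; last by rewrite (negPf ij).
  by exists i, j.
by exists j, i; split=> // k l; rewrite -vgeN; have := Nij k l; rewrite !mxE opprB.
Qed.

Lemma act_vertex_expg_fix g p k : act_vertex g p = p -> act_vertex (g ^+ k)%g p = p.
Proof.
by move=> gp; elim: k => [|k IH]; rewrite ?act_vertex1// expgS act_vertexM IH.
Qed.

(** Two powers of [g] agree modulo pi^(N - c). Multiplying their difference by an inverse power,
    which fixes [p] too, costs at most [c], so a positive power is congruent to 1 modulo pi^N. *)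
Lemma discrete_stabilizer_torsion (H : set (SL2 K)) N g p :
  (forall k, H (g ^+ k)%g) ->
  (forall g, H g -> mx_vge N (1%:M - mx_of_SL2 g) -> g = 1%g) ->
  act_vertex g p = p -> exists k, (g ^+ k.+1)%g = 1%g.
Proof.
move=> Hg hN gp; have [c hc] := stabilizer_bounded p.
have [i [j [ij hij]]] := @mx_pigeonhole c (N - c) (fun k => mx_of_SL2 (g ^+ k)%g)
  (fun k => hc _ (act_vertex_expg_fix k gp)).
exists (j - i).-1; rewrite prednK ?subn_gt0//; apply: hN; first exact: Hg.
have gi : act_vertex (g ^+ i)^-1%g p = p.
  by rewrite -{1}(act_vertex_expg_fix i gp) actK.
have -> : 1%:M - mx_of_SL2 (g ^+ (j - i))%g =
    mx_of_SL2 (g ^+ i)^-1%g *m (mx_of_SL2 (g ^+ i)%g - mx_of_SL2 (g ^+ j)%g).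
  rewrite mulmxBr mx_mulVg; congr (_ - _).
  have -> : (g ^+ (j - i))%g = ((g ^+ i)^-1 * g ^+ j)%g.
    by rewrite -{2}(subnKC (ltnW ij)) expgnDr mulKg.
  by [].
by have := mx_vgeM (hc _ gi) hij; rewrite subrKC.
Qed.

End discreteness.

(** * The procedure *)

Section procedure.
Variables (R : realType) (K : localFieldType).
Implicit Types (X Y Z g : SL2 K).

Lemma translation_length_eq0 g : translation_length R g = 0%E <-> ell g = 0%N.
Proof.
rewrite translation_lengthE; split=> [[]/eqP|->] //.
by rewrite pnatr_eq0 => /eqP.
Qed.

Definition min_ell X Y : nat := minn (ell (X * Y)%g) (ell (X^-1 * Y)%g).

Lemma min_lengthE X Y : min_length R X Y = (min_ell X Y)%:R%:E.
Proof.
rewrite /min_length /min_ell !translation_lengthE -EFin_min; congr _%:E.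
case: leqP => h; first by rewrite min_l// ler_nat.
by rewrite min_r// ler_nat ltnW.
Qed.

Lemma min_length_eq0 X Y : min_length R X Y = 0%E <-> min_ell X Y = 0%N.
Proof.
rewrite min_lengthE; split=> [[]/eqP|->] //.
by rewrite pnatr_eq0 => /eqP.
Qed.

Lemma min_length_le X Y :
  (min_length R X Y <= translation_length R Y - translation_length R X)%E =
  (min_ell X Y + ell X <= ell Y)%N.
Proof.
by rewrite min_lengthE !translation_lengthE -EFinB lee_fin lerBrDr -natrD ler_nat.
Qed.

(** A replacement gives Y a length at most [ell Y - ell X]; as [ell X] is positive, the sum of the
    lengths decreases. *)
Lemma terminates_Sort X Y : (0 < ell X)%N -> (0 < ell Y)%N -> terminates R (Sort X Y).
Proof.
have [k] := ubnP (ell X + ell Y); elim: k X Y => // k IH.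
have tTest X Y : (ell X + ell Y < k.+1)%N -> (0 < ell X)%N -> (0 < ell Y)%N ->
    (ell X <= ell Y)%N -> terminates R (Test X Y).
  move=> hk lX lY lXY; apply: terminates_step.
    have [m0|m0] := pselect (min_length R X Y = 0%E); first by eexists;
      exact: step_false.
    have [ml|ml] := leP (min_length R X Y) (translation_length R Y -
      translation_length R X)%E.
      have [mE|mE] : translation_length R (X * Y)%g = min_length R X Y \/
          translation_length R (X^-1 * Y)%g = min_length R X Y.
        by rewrite /min_length; case: leP; [left|right].
      - by exists (Sort X (X * Y)%g); apply: step_replace mE => //; left.
      - by exists (Sort X (X^-1 * Y)%g); apply: step_replace mE => //; right.
    by eexists; exact: step_true.
  move=> s st; inversion st as [| | | | | X' Y' Z m0 ml ZE lZ eX eY|]; subst.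
  - exact: terminates_return.
  - move: lZ m0 ml; rewrite min_length_le min_lengthE translation_lengthE => -[/eqP].
    rewrite eqr_nat => /eqP lZ m0 ml.
    have {}m0 : min_ell X Y <> 0%N by move=> e; apply: m0; rewrite e.
    by apply: IH; lia.
  - exact: terminates_return.
move=> X Y hk lX lY; apply: terminates_step.
  have [lXY|lYX] := leP (translation_length R X) (translation_length R Y).
    by exists (Test X Y); exact: step_noswap.
  by exists (Test Y X); exact: step_swap.
move=> s st; inversion st as [| | X' Y' h eX eY|X' Y' h eX eY | | |]; subst.
- apply: tTest => //; first by rewrite addnC.
  by move: h; rewrite !translation_lengthE lte_fin ltr_nat => /ltnW.
- by apply: tTest => //; move: h; rewrite !translation_lengthE lee_fin ler_nat.
Qed.

Lemma terminates_Start (A B : SL2 K) : terminates R (Start A B).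
Proof.
have [h|h] := pselect (translation_length R A = 0%E \/ translation_length R B = 0%E).
  apply: terminates_step; first by exists (Return None); exact: step_elliptic.
  move=> s st; inversion st as [|A' B' h1 h2 | | | | |]; subst;
    first exact: terminates_return.
  by case: h.
apply: terminates_step.
  by exists (Sort A B); apply: step_start => e; apply: h; [left|right].
move=> s st; inversion st as [|A' B' h1 h2 | | | | |]; subst;
  first exact: terminates_return.
by apply: terminates_Sort; rewrite lt0n; apply/eqP => /translation_length_eq0.
Qed.

Definition hyperbolic_pair (G : set (SL2 K)) X Y :=
  [/\ (0 < ell X)%N, (0 < ell Y)%N & generated [set X; Y] = G].

(** The invariant of a run. A false answer keeps a generating pair as witness; a true one records
    the negated test of step (5), made symmetric in X and Y. *)
Definition reachable (A B : SL2 K) (s : state K) : Prop :=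
  let G := generated [set A; B] in
  match s with
  | Start X Y => X = A /\ Y = B
  | Sort X Y => hyperbolic_pair G X Y
  | Test X Y => hyperbolic_pair G X Y /\ (ell X <= ell Y)%N
  | Return (Some (X, Y)) => hyperbolic_pair G X Y /\
      (maxn (ell X) (ell Y) < min_ell X Y + minn (ell X) (ell Y))%N
  | Return None => exists X Y, generated [set X; Y] = G /\
      [\/ ell X = 0%N, ell Y = 0%N | min_ell X Y = 0%N]
  end.

Lemma reachable_step A B s s' : reachable A B s -> proc_step R s s' -> reachable A B s'.
Proof.
move=> rs st; case: st rs => {s s'} /=.
- move=> X Y h [XA YB]; exists A, B; rewrite -XA -YB; split=> //.
  by case: h => /translation_length_eq0 e; [exact: Or31|exact: Or32].
- move=> X Y /translation_length_eq0/eqP hX /translation_length_eq0/eqP hY [eX eY].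
  by split; rewrite ?lt0n// eX eY.
- move=> X Y; rewrite !translation_lengthE lte_fin ltr_nat => lt [hX hY gE].
  by split; [split=> //; rewrite generated_swap|exact: ltnW].
- by move=> X Y; rewrite !translation_lengthE lee_fin ler_nat.
- move=> X Y /min_length_eq0 m0 [[_ _ gE] _]; exists X, Y; split=> //; exact: Or33.
- move=> X Y Z /min_length_eq0 m0 _ ZE;
  rewrite min_lengthE translation_lengthE => -[/eqP].
  rewrite eqr_nat => /eqP lZ [[hX hY gE] _]; split=> //; first by rewrite lZ lt0n;
    apply/eqP.
  case: ZE => ->; first by rewrite generated_mulr.
  by rewrite -generated_invl generated_mulr generated_invl.
- move=> X Y /min_length_eq0 m0; rewrite ltNge min_length_le => ml [h1 h2]; split=> //.
  by lia.
Qed.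

Lemma may_return_reachable A B o : may_return R A B o -> reachable A B (Return o).
Proof.
rewrite /may_return => ret.
suff main s s' : Relation_Operators.clos_refl_trans_1n (state K) (@proc_step R K) s
  s' ->
    reachable A B s -> reachable A B s' by exact: (main _ _ ret).
by elim=> // {}s t {}s' st _ IH /reachable_step/(_ st).
Qed.

Lemma hyperbolic_pair_schottky (G : set (SL2 K)) X Y : hyperbolic_pair G X Y ->
  (maxn (ell X) (ell Y) < min_ell X Y + minn (ell X) (ell Y))%N ->
  [/\ ping_pong R X Y, free_of_rank_two G & discrete_subgroup G].
Proof.
move=> [lX lY GE] lm.
suff main Y' : (0 < ell Y')%N -> generated [set X; Y'] = G ->
    forall p, schottky X Y' p ->
      [/\ ping_pong R X Y', free_of_rank_two G & discrete_subgroup G].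
  have [||p [hp|hp]] := @schottky_ex _ X Y lX lY; try by move: lm;
    rewrite /min_ell; lia.
    exact: main hp.
  have [||h1 h2 h3] := main Y^-1%g _ _ p hp; rewrite ?ellV ?generated_invr//.
  by split=> //; exact: ping_pongV.
move=> lY' GE' p hp; split.
- exact: schottky_ping_pong hp R.
- by rewrite -GE'; exact: schottky_free hp.
have [N hN] := stabilizer_vge p.
apply: (@vge_discrete_subgroup _ _ N); rewrite -GE'.
  by move=> g h hg hh; apply: generatedM => //; exact: generatedV.
by move=> g Gg /hN; exact: schottky_trivial_stabilizer Gg.
Qed.

Lemma elliptic_trivial X Y g :
  let G := generated [set X; Y] in
  discrete_subgroup G -> free_of_rank_two G -> G g -> ell g = 0%N -> g = 1%g.
Proof.
move=> G disc free Gg g0; have [p pE] := ell_ex g.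
have gp : act_vertex g p = p by apply/esym/vdist_eq0; rewrite pE.
have [N hN] := discrete_subgroup_vge disc (@generated1 _ _).
have Gk k : G (g ^+ k)%g.
  elim: k => [|k IH]; first exact: generated1.
  by rewrite expgS; exact: generatedM.
have [k gk] := discrete_stabilizer_torsion Gk hN gp.
exact: (free_torsion_free free (@generated1 _ _) Gg gk).
Qed.

(** Elements of translation length zero are trivial, so X, Y or a product of them is trivial. Then X
    and Y commute and the group is abelian, hence not free of rank two. *)
Lemma discrete_free_hyperbolic X Y :
  let G := generated [set X; Y] in
  discrete_subgroup G -> free_of_rank_two G ->
  ~ [\/ ell X = 0%N, ell Y = 0%N | min_ell X Y = 0%N].
Proof.
move=> G disc free h.
have triv g : ell g = 0%N -> G g -> g = 1%g by move=> g0 Gg;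
  exact: (elliptic_trivial disc free).
have GX : G X by apply: mem_generated; left.
have GY : G Y by apply: mem_generated; right.
have cXY : commute X Y.
  have [e|e|e] : [\/ X = 1%g, Y = 1%g | Y = X \/ Y = X^-1%g].
  - case: h => [/triv/(_ GX) e|/triv/(_ GY) e|m0];
    [exact: Or31|exact: Or32|apply: Or33].
    have [/triv e|/triv e] : ell (X * Y)%g = 0%N \/ ell (X^-1 * Y)%g = 0%N.
      by move: m0; rewrite /min_ell; lia.
    - by right; rewrite -[LHS](mulKg X) e ?mulg1//; exact: generatedM.
    - left; rewrite -[LHS](mulVKg X) e ?mulg1//.
      by apply: generatedM => //; exact: generatedV.
  - by rewrite e; apply: commute_sym; exact: commute1.
  - by rewrite e; exact: commute1.
  - case: e => ->; first exact: commute_refl.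
    by apply: commuteV; exact: commute_refl.
have [x [y [Gx Gy]]] := free_noncommutative free (@generatedM _ _).
by apply; exact: generated_commute cXY Gx Gy.
Qed.

End procedure.

Theorem theorem4p2 (R : realType) (K : localFieldType) (A B : SL2 K) :
  let G := generated [set A; B] in
  [/\ terminates R (Start A B),
      discrete_subgroup G -> free_of_rank_two G ->
        forall o, may_return R A B o ->
          exists X Y, [/\ o = Some (X, Y), generated [set X; Y] = G &
                          ping_pong R X Y] &
      ~ (discrete_subgroup G /\ free_of_rank_two G) ->
        forall o, may_return R A B o -> o = None].
Proof.
move=> G; split.
- exact: terminates_Start.
- move=> disc free [[X Y]|] /may_return_reachable /=.
    move=> [hXY lm]; have [pp _ _] := hyperbolic_pair_schottky R hXY lm.
    by case: hXY => _ _ GE; exists X, Y.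
  move=> [X [Y [GE h]]]; exfalso; rewrite /G -GE in disc free.
  exact: discrete_free_hyperbolic disc free h.
- move=> nG [[X Y]|] // /may_return_reachable /= [hXY lm]; exfalso; apply: nG.
  by have [_ free disc] := hyperbolic_pair_schottky R hXY lm.
Qed.
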